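(* The completeness and soundness parameters in $\mathsf{QCPCP}$ can be made exponentially close in $t\in\mathbb{N}$ to $1$ and $0$ respectively, i.e. $c=1-2^{-\Omega(t)}$ and $s=2^{-\Omega(t)}$, by making $tq$ instead of $q$ queries to the classical proof. That is, every promise problem in $\mathsf{QCPCP}[q]$ has, for a proof length $p(n)\leq\mathrm{poly}(n)$, a $(p(n),t\,q(n),1-2^{-\Omega(t)},2^{-\Omega(t)})$-$\mathsf{QCPCP}$-verifier.
   Context: Let $n$ be the input size, $p,q:\mathbb{N}\to\mathbb{N}$ and $c,s$ with $c-s>0$. A promise problem $A=(A_{\mathrm{yes}},A_{\mathrm{no}})$ has a $(p(n),q(n),c,s)$-$\mathsf{QCPCP}$-verifier if there exists a (polynomial-time) quantum algorithm $V$ which acts on an input $|x\rangle$ and a polynomial number of ancilla qubits, plus an additional bit string $y\in\{0,1\}^{p(n)}$ from which it may read at most $q(n)$ bits non-adaptively (the indices to be read are determined by measuring designated index qubits; the bits read are then supplied as basis-state qubits), followed by a measurement of the first qubit, accepting only if the outcome is $|1\rangle$, such that: (completeness) if $x\in A_{\mathrm{yes}}$ there is $y\in\{0,1\}^{p(n)}$ such that $V$ accepts with probability at least $c$; (soundness) if $x\in A_{\mathrm{no}}$ then for all $y\in\{0,1\}^{p(n)}$ $V$ accepts with probability at most $s$. $\mathsf{QCPCP}[p,q,c,s]$ is the class of promise problems with such a verifier; if $p(n)\le\mathrm{poly}(n)$, $c=2/3$, $s=1/3$ one writes $\mathsf{QCPCP}[q]$. *)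

(* Defs.v *)
From mathcomp Require Import all_boot all_order all_algebra.
From mathcomp Require Import complex.
From mathcomp Require Import all_classical all_reals all_analysis.

Set Implicit Arguments.
Unset Strict Implicit.
Unset Printing Implicit Defensive.

Import Order.TTheory GRing.Theory Num.Theory.

Local Open Scope ring_scope.

(** The machine model is a Turing machine with finitely many one-sided work
    tapes (stacks of bits, head of the list = top) and structured finite
    control.  A two-sided tape is a pair of stacks, and every instruction and
    every test moves or reads one head and costs one step. *)

Inductive test : Type :=
| Top (r : nat)        (* the top of stack r exists and is the bit true *)
| Nonempty (r : nat).

Inductive prog : Type :=
| Skip
| Push (r : nat) (b : bool)
| Pop (r : nat)
| Seq (P Q : prog)
| If (c : test) (P Q : prog)
| While (c : test) (P : prog).

Definition store : Type := nat -> seq bool.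

Definition upd (s : store) (r : nat) (l : seq bool) : store :=
  fun r' => if r' == r then l else s r'.

Definition holds (s : store) (c : test) : bool :=
  match c with
  | Top r => head false (s r)
  | Nonempty r => s r != [::]
  end.

(** [exec P s s' k]: started in [s], [P] halts in [s'] after exactly [k]
    steps. *)
Inductive exec : prog -> store -> store -> nat -> Prop :=
| ExecSkip s : exec Skip s s 1
| ExecPush r b s : exec (Push r b) s (upd s r (b :: s r)) 1
| ExecPop r s : exec (Pop r) s (upd s r (behead (s r))) 1
| ExecSeq P Q s1 s2 s3 k l :
    exec P s1 s2 k -> exec Q s2 s3 l -> exec (Seq P Q) s1 s3 (k + l)
| ExecIfTrue c P Q s s' k :
    holds s c -> exec P s s' k -> exec (If c P Q) s s' k.+1
| ExecIfFalse c P Q s s' k :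
    ~~ holds s c -> exec Q s s' k -> exec (If c P Q) s s' k.+1
| ExecWhileTrue c P s1 s2 s3 k l :
    holds s1 c -> exec P s1 s2 k -> exec (While c P) s2 s3 l ->
    exec (While c P) s1 s3 (k + l).+1
| ExecWhileFalse c P s : ~~ holds s c -> exec (While c P) s s 1.

Definition poly_bounded (f : nat -> nat) : Prop :=
  exists T : {poly nat}, forall n, (f n <= T.[n])%N.

(** [g] is computable in polynomial time from the unary input [1^n]; input and
    output are on stack 0. *)
Definition poly_time (g : nat -> seq bool) : Prop :=
  exists (P : prog) (time : nat -> nat), poly_bounded time /\
    forall n, exists (s' : store) (k : nat),
      [/\ exec P (upd (fun=> [::]) 0 (nseq n true)) s' k,
          (k <= time n)%N & s' 0%N = g n].

(** The universal set {H, T, CNOT}, plus X and Toffoli, which are exact words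
    over it. *)

Inductive gate : Type :=
| GX (i : nat)
| GH (i : nat)                (* Hadamard *)
| GT (i : nat)                (* diag(1, exp(i pi / 4)) *)
| GCNOT (i j : nat)           (* control i, target j *)
| GToffoli (i j k : nat).     (* controls i, j, target k *)

Definition gate_wires (g : gate) : seq nat :=
  match g with
  | GX i | GH i | GT i => [:: i]
  | GCNOT i j => [:: i; j]
  | GToffoli i j k => [:: i; j; k]
  end.

Definition gate_tag (g : gate) : nat :=
  match g with
  | GX _ => 0 | GH _ => 1 | GT _ => 2 | GCNOT _ _ => 3 | GToffoli _ _ _ => 4
  end.

(** Distinctness of the wires is what makes [apply_gate] below unitary. *)
Definition gate_wf (m : nat) (g : gate) : bool :=
  uniq (gate_wires g) && all (fun i => i < m)%N (gate_wires g).

(** The verifier on inputs of length [n]: it runs [vpre] on the [n] input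
    qubits (wires [0 .. n-1]) and [vanc] ancillas, measures all the wires in
    [vqueries] (each entry lists the qubits holding one index in binary, least
    significant bit first), receives the bits read on [size vqueries] further
    wires, and runs [vpost] on all the wires. *)
Record vcircuit : Type := VCircuit {
  vanc : nat;
  vpre : seq gate;
  vqueries : seq (seq nat);
  vpost : seq gate
}.

Definition vcircuit_wf (n : nat) (V : vcircuit) : bool :=
  [&& all (gate_wf (n + vanc V)) (vpre V),
      all (fun i => i < n + vanc V)%N (flatten (vqueries V)) &
      all (gate_wf (n + vanc V + size (vqueries V))) (vpost V)].

(** Self-delimiting encoding of circuits.  Numbers (in particular the number of
    ancillas) are written in unary, so that a circuit written down in polynomial
    time acts on polynomially many qubits. *)
Definition enc_seq (T : Type) (e : T -> seq bool) (s : seq T) : seq bool :=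
  foldr (fun x r => true :: e x ++ r) [:: false] s.

Definition enc_nat (k : nat) : seq bool := rcons (nseq k true) false.

Definition enc_gate (g : gate) : seq bool :=
  enc_seq enc_nat (gate_tag g :: gate_wires g).

Definition enc_vcircuit (V : vcircuit) : seq bool :=
  enc_nat (vanc V) ++ enc_seq enc_gate (vpre V) ++
  enc_seq (enc_seq enc_nat) (vqueries V) ++ enc_seq enc_gate (vpost V).

Definition prefix_code (T : Type) (e : T -> seq bool) : Prop :=
  forall x y r r', e x ++ r = e y ++ r' -> x = y /\ r = r'.

Lemma enc_nat_prefix : prefix_code enc_nat.
Proof.
rewrite /enc_nat; elim=> [|x IH] [|y] r r' //=; first by case.
by case=> /IH[-> ->].
Qed.

Lemma enc_seq_prefix (T : Type) (e : T -> seq bool) :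
  prefix_code e -> prefix_code (enc_seq e).
Proof.
move=> eP; elim=> [|x s IH] [|y u] r r' //=; first by case.
by case; rewrite -!catA => /eP[-> /IH[-> ->]].
Qed.

Lemma enc_gate_prefix : prefix_code enc_gate.
Proof.
move=> g h r r' /(enc_seq_prefix enc_nat_prefix)[E ->]; split=> //.
by case: g h E => [i|i|i|i j|i j k] [i'|i'|i'|i' j'|i' j' k'] //= [];
   repeat move=> ->.
Qed.

Lemma enc_vcircuit_inj : injective enc_vcircuit.
Proof.
move=> [a1 p1 q1 o1] [a2 p2 q2 o2]; rewrite /enc_vcircuit /=.
move=> /enc_nat_prefix[-> /(enc_seq_prefix enc_gate_prefix)[-> E]].
have [-> E'] := enc_seq_prefix (enc_seq_prefix enc_nat_prefix) E.
rewrite -[enc_seq _ o1]cats0 -[enc_seq _ o2]cats0 in E'.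
by have [->] := enc_seq_prefix enc_gate_prefix E'.
Qed.

Definition poly_time_family (V : nat -> vcircuit) : Prop :=
  poly_time (fun n => enc_vcircuit (V n)).

Section Semantics.
Variable R : realType.
Local Notation C := R[i].

(** Amplitudes in the computational basis; not necessarily normalised, since
    measurement outcomes are tracked by projected states. *)
Definition state (m : nat) : Type := m.-tuple bool -> C.

Definition flip (m : nat) (i : nat) (b : m.-tuple bool) : m.-tuple bool :=
  [tuple tnth b j (+) (val j == i) | j < m].

Definition apply_gate (m : nat) (g : gate) (psi : state m) : state m :=
  fun b =>
  let bit := nth false b in
  match g with
  | GX i => psi (flip i b)
  | GH i => ((-1) ^+ bit i * psi b + psi (flip i b)) / (Num.sqrt 2)%:C%C
  | GT i => ((1 +i* 1)%C / (Num.sqrt 2)%:C%C) ^+ bit i * psi b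
  | GCNOT i j => psi (if bit i then flip j b else b)
  | GToffoli i j k => psi (if bit i && bit j then flip k b else b)
  end.

Definition run (m : nat) (gs : seq gate) (psi : state m) : state m :=
  foldl (fun phi g => apply_gate g phi) psi gs.

Definition ket (m : nat) (w : seq bool) : state m :=
  fun b => (val b == w)%:R.

Arguments ket : clear implicits.

(** Projection onto the outcome [o] of measuring the wires [ws]. *)
Definition project (m : nat) (ws : seq nat) (o : seq bool) (psi : state m) :
    state m :=
  fun b => if [seq nth false b i | i <- ws] == o then psi b else 0.

(** Tensor product of [psi] with the basis state [a] of [k] new wires. *)
Definition supply (m k : nat) (a : seq bool) (psi : state m) : state (m + k)%N :=
  fun b => if drop m b == a then psi [tuple nth false b i | i < m] else 0.

Arguments supply {m} k a psi.

Definition bits_to_nat (s : seq bool) : nat :=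
  foldr (fun (b : bool) r => b + r.*2)%N 0%N s.

(** The bits of the proof [y] at the measured indices; an index outside the
    proof reads 0. *)
Definition bits_read (V : vcircuit) (y o : seq bool) : seq bool :=
  [seq nth false y (bits_to_nat l) | l <- reshape (shape (vqueries V)) o].

Definition sqmod (z : C) : R := (complex.Re z) ^+ 2 + (complex.Im z) ^+ 2.

(** Unnormalised final state when the index measurement has outcome [o]. *)
Definition final_state (V : vcircuit) (x y o : seq bool) :
    state (size x + vanc V + size (vqueries V))%N :=
  run (vpost V)
    (supply (size (vqueries V)) (bits_read V y o)
      (project (flatten (vqueries V)) o
        (run (vpre V) (ket (size x + vanc V)%N (x ++ nseq (vanc V) false))))).

Arguments final_state : clear implicits.

Definition accept_prob (V : vcircuit) (x y : seq bool) : R :=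
  \sum_(o : (size (flatten (vqueries V))).-tuple bool)
    \sum_(b : (size x + vanc V + size (vqueries V))%N.-tuple bool |
          nth false b 0)
      sqmod (final_state V x y o b).

Record promise_problem : Type := PromiseProblem {
  yes_instance : set (seq bool);
  no_instance : set (seq bool);
  yes_no_disjoint : (yes_instance `&` no_instance = set0)%classic
}.

Definition QCPCP_verifier (p q : nat -> nat) (c s : R) (A : promise_problem)
    (V : nat -> vcircuit) : Prop :=
  [/\ poly_time_family V,
      forall n, vcircuit_wf n (V n),
      forall n, (size (vqueries (V n)) <= q n)%N,
      forall x, yes_instance A x ->
        exists y : (p (size x)).-tuple bool,
          c <= accept_prob (V (size x)) x y
    & forall x, no_instance A x ->
        forall y : (p (size x)).-tuple bool,
          accept_prob (V (size x)) x y <= s].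

Definition QCPCP (p q : nat -> nat) (c s : R) (A : promise_problem) : Prop :=
  0 < c - s /\ exists V, QCPCP_verifier p q c s A V.

Definition QCPCPq (q : nat -> nat) (A : promise_problem) : Prop :=
  exists2 p, poly_bounded p & QCPCP p q (2 / 3) (1 / 3) A.

Definition is_Omega_id (f : nat -> R) : Prop :=
  exists2 a : R, 0 < a & exists t0 : nat, forall t, (t0 <= t)%N -> a * t%:R <= f t.

End Semantics.

(* Main.v *)
Require Import Defs.
From mathcomp Require Import all_boot all_order all_algebra.
From mathcomp Require Import all_classical all_reals all_analysis.
From mathcomp Require Import complex.
From mathcomp Require Import zify ring lra.

(** Run [t] copies of the verifier on disjoint blocks of wires and output the
    strict majority of their answers.  Measured blockwise, the final state is a
    product of final states of the original verifier, so the joint distribution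
    of the [t] answers is a product and a Chernoff bound applies: with the
    weights [sqrt 2] and [1 / sqrt 2] the error is at most
    [(2 sqrt 2 / 3) ^ t].  When this is still above 1/3 (small [t]) a single copy
    is at least as good.

    Uniformity: the code of the new circuit is a concatenation of images of the
    code of the old one, of its unary parameters and of constants under finite
    transducers, so it is enough to run one transducer on outputs of
    polynomial-time programs. *)

Set Implicit Arguments.
Unset Strict Implicit.
Unset Printing Implicit Defensive.

Import Order.TTheory GRing.Theory Num.Theory.
Local Open Scope ring_scope.
Local Open Scope nat_scope.

(** * Programs: renaming, Hoare rules, transducers *)

(** Repetition needs no longer proof: the proof is classical, so all copies read the same [y], and
    once [y] is fixed their answers are independent. Likewise the input is a basis state, so CNOT
    gates can fan it out. The copies run in parallel because the model has a single round of
    non-adaptive queries. The price is that the joint state of all wires must be followed. It is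
    kept as a function that factors over windows of wires, times a factor for the remaining ones.
    Outcomes of the index measurement are treated one at a time, so the supplied bits are again a
    basis state and copying them into the blocks preserves the product form. Only the final vote
    couples the blocks; it is a classical reversible circuit, hence a permutation of basis states.
    Since [t] is fixed before [n], the voting circuit is a constant: its size does not matter, and
    uniformity concerns the dependence on [n] alone. *)

Lemma poly_bounded_le f g :
  poly_bounded g -> (forall n, f n <= g n) -> poly_bounded f.
Proof. by move=> [T gT] fg; exists T => n; apply: leq_trans (gT n). Qed.

Lemma poly_boundedD f g :
  poly_bounded f -> poly_bounded g -> poly_bounded (fun n => f n + g n).
Proof.
move=> [T fT] [U gU]; exists (T + U)%R => n.
by rewrite hornerD; apply: leq_add.
Qed.

Lemma poly_boundedM f g :
  poly_bounded f -> poly_bounded g -> poly_bounded (fun n => f n * g n).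
Proof.
move=> [T fT] [U gU]; exists (T * U)%R => n.
by rewrite hornerM; apply: leq_mul.
Qed.

Lemma poly_bounded_const c : poly_bounded (fun=> c).
Proof. by exists (c%:P)%R => n; rewrite hornerC. Qed.

Lemma poly_bounded_id : poly_bounded id.
Proof. by exists 'X%R => n; rewrite hornerX. Qed.

(** * Renaming stacks, and time as a bound on space *)

Definition ren_test (h : nat -> nat) (c : test) : test :=
  match c with Top r => Top (h r) | Nonempty r => Nonempty (h r) end.

Fixpoint ren (h : nat -> nat) (P : prog) : prog :=
  match P with
  | Skip => Skip
  | Push r b => Push (h r) b
  | Pop r => Pop (h r)
  | Seq P Q => Seq (ren h P) (ren h Q)
  | If c P Q => If (ren_test h c) (ren h P) (ren h Q)
  | While c P => While (ren_test h c) (ren h P)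
  end.

(** The last clause is a frame property: with injective renamings of disjoint ranges, several
    programs can run one after the other in one store without disturbing each other. *)
Lemma exec_ren (h : nat -> nat) P s s' k (S : store) :
  injective h -> exec P s s' k -> S \o h =1 s ->
  exists S', [/\ exec (ren h P) S S' k, S' \o h =1 s' &
    forall r, (forall r', r <> h r') -> S' r = S r].
Proof.
move=> hI e; elim: e S => {P s s' k} /=.
- by move=> s S Ss; exists S; split=> //; constructor.
- move=> r b s S Ss; exists (upd S (h r) (b :: S (h r))); split.
  + by constructor.
  + by move=> r' /=; rewrite /upd (inj_eq hI) -!Ss.
  + by move=> r' /(_ r); rewrite /upd; case: eqP.
- move=> r s S Ss; exists (upd S (h r) (behead (S (h r)))); split.
  + by constructor.
  + by move=> r' /=; rewrite /upd (inj_eq hI) -!Ss.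
  + by move=> r' /(_ r); rewrite /upd; case: eqP.
- move=> P Q s1 s2 s3 k l _ IP _ IQ S /IP[S1 [e1 /IQ[S2 [e2 E2 F2]] F1]].
  exists S2; split=> //; first exact: ExecSeq e1 e2.
  by move=> r hr; rewrite F2 ?F1.
- move=> c P Q s s' k hc _ IP S Ss; have [S1 [e1 E1 F1]] := IP S Ss.
  exists S1; split=> //; apply: ExecIfTrue => //.
  by case: (c) hc => r /=; rewrite -Ss.
- move=> c P Q s s' k hc _ IP S Ss; have [S1 [e1 E1 F1]] := IP S Ss.
  exists S1; split=> //; apply: ExecIfFalse => //.
  by case: (c) hc => r /=; rewrite -Ss.
- move=> c P s1 s2 s3 k l hc _ IP _ IQ S Ss.
  have [S1 [e1 /IQ[S2 [e2 E2 F2]] F1]] := IP S Ss.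
  exists S2; split=> //; last by move=> r hr; rewrite F2 ?F1.
  apply: ExecWhileTrue e1 e2.
  by case: (c) hc => r /=; rewrite -Ss.
- move=> c P s hc S Ss; exists S; split=> //; apply: ExecWhileFalse.
  by case: (c) hc => r /=; rewrite -Ss.
Qed.

(** One step pushes at most one bit, so a polynomial-time program has output of polynomial
    length. *)
Lemma exec_size P s s' k r : exec P s s' k -> size (s' r) <= size (s r) + k.
Proof.
elim=> {P s s' k} /=.
- by move=> s; rewrite leq_addr.
- by move=> r' b s; rewrite /upd; case: eqP => [->|_] /=; lia.
- by move=> r' s; rewrite /upd; case: eqP => [->|_] /=; rewrite ?size_behead; lia.
- lia.
- lia.
- lia.
- lia.
- lia.
Qed.

(** * Total correctness with a time bound *)

Definition run_in (P : prog) (s : store) (T : nat) (Q : store -> Prop) : Prop :=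
  exists s' k, [/\ exec P s s' k, k <= T & Q s'].

Lemma run_in_weak P s T T' (Q Q' : store -> Prop) :
  run_in P s T Q -> T <= T' -> (forall s', Q s' -> Q' s') -> run_in P s T' Q'.
Proof.
move=> [s' [k [e kT Qs]]] TT QQ; exists s', k; split=> //; last exact: QQ.
exact: leq_trans TT.
Qed.

Lemma run_in_seq P1 P2 s T1 T2 (Q1 Q2 : store -> Prop) :
  run_in P1 s T1 Q1 -> (forall s', Q1 s' -> run_in P2 s' T2 Q2) ->
  run_in (Seq P1 P2) s (T1 + T2) Q2.
Proof.
move=> [s1 [k1 [e1 kT1 Q1s]]] /(_ _ Q1s)[s2 [k2 [e2 kT2 Q2s]]].
by exists s2, (k1 + k2); split=> //; [exact: ExecSeq e1 e2 | exact: leq_add].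
Qed.

Lemma run_in_if c P1 P2 s T (Q : store -> Prop) :
  run_in (if holds s c then P1 else P2) s T Q -> run_in (If c P1 P2) s T.+1 Q.
Proof.
case: ifP => hc [s' [k [e kT Qs]]]; exists s', k.+1; split=> //.
  exact: ExecIfTrue.
by apply: ExecIfFalse; rewrite ?hc.
Qed.

Lemma run_in_push r b s (Q : store -> Prop) :
  Q (upd s r (b :: s r)) -> run_in (Push r b) s 1 Q.
Proof. by move=> ?; exists (upd s r (b :: s r)), 1; split=> //; constructor. Qed.

Lemma run_in_pop r s (Q : store -> Prop) :
  Q (upd s r (behead (s r))) -> run_in (Pop r) s 1 Q.
Proof. by move=> ?; exists (upd s r (behead (s r))), 1; split=> //; constructor. Qed.

Lemma run_in_skip s (Q : store -> Prop) : Q s -> run_in Skip s 1 Q.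
Proof. by move=> ?; exists s, 1; split=> //; constructor. Qed.

Lemma run_in_while c P s T1 T2 (Q1 Q2 : store -> Prop) :
  holds s c -> run_in P s T1 Q1 ->
  (forall s', Q1 s' -> run_in (While c P) s' T2 Q2) ->
  run_in (While c P) s (T1 + T2).+1 Q2.
Proof.
move=> hc [s1 [k1 [e1 kT1 Q1s]]] /(_ _ Q1s)[s2 [k2 [e2 kT2 Q2s]]].
exists s2, (k1 + k2).+1; split=> //; first exact: ExecWhileTrue e1 e2.
by rewrite ltnS; exact: leq_add.
Qed.

Definition pushes (b : bool) (rs : seq nat) : prog :=
  foldr (fun r => Seq (Push r b)) Skip rs.

Definition mv (a : nat) (rs : seq nat) : prog :=
  While (Nonempty a)
    (Seq (If (Top a) (pushes true rs) (pushes false rs)) (Pop a)).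

Lemma run_pushes b rs s : uniq rs ->
  run_in (pushes b rs) s (size rs).+1
    (fun s' => s' =1 fun r => if r \in rs then b :: s r else s r).
Proof.
elim: rs s => [|r rs IH] s /=; first by move=> _; apply: run_in_skip.
move=> /andP[rrs urs]; rewrite -add1n.
apply: (@run_in_seq _ _ _ _ _ (eq^~ (upd s r (b :: s r)))).
  exact: run_in_push.
move=> _ ->; apply: run_in_weak (IH _ urs) _ _ => // s' E x.
rewrite E /upd inE; case: (eqVneq x r) => [->|//].
by rewrite (negPf rrs).
Qed.

Lemma run_mv a rs s : a \notin rs -> uniq rs ->
  run_in (mv a rs) s (size (s a) * (size rs + 4)).+1
    (fun s' => s' =1 fun r => if r == a then [::]
                              else if r \in rs then rev (s a) ++ s r else s r).
Proof.
move=> ars urs; move: {2}(s a) (erefl (s a)) => l; elim: l s => [|b l IH] s sa.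
  rewrite sa; exists s, 1; split=> //; first by apply: ExecWhileFalse; rewrite /= sa.
  by move=> r; case: eqP => [->//|_]; case: ifP.
rewrite sa (_ : _.+1 = (((size rs).+2 + 1) +
  (size l * (size rs + 4)).+1).+1); last by rewrite /=; lia.
apply: (@run_in_while _ _ _ _ _ (fun s' => s' =1 fun r => if r == a then l
                              else if r \in rs then b :: s r else s r)).
- by rewrite /= sa.
- apply: (@run_in_seq _ _ _ _ _ (fun s' => s' =1 fun r => if r \in rs then b :: s r else s r)).
    apply: run_in_if; rewrite /= sa /=.
    rewrite (_ : (if b then _ else _) = pushes b rs); last by clear; case: b.
    exact: run_pushes.
  move=> s' E; apply: run_in_pop => r; rewrite /upd; case: eqP => [_|_].
    by rewrite E (negPf ars) sa.
  by rewrite E.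
move=> s' E; have E' : s' a = l by rewrite E eqxx.
apply: run_in_weak (IH _ E') _ _; first by rewrite E'; lia.
move=> s'' E'' r; rewrite E''; case: eqP => // /eqP /negPf ra.
by rewrite E' (E r) ra; case: (r \in rs); rewrite ?rev_cons ?cat_rcons.
Qed.

(** * Finite transducers and the programs that run them *)

Inductive action : Type := Bit (b : bool) | CopyV | CopyW | CopyPos.

(** A deterministic finite transducer with states [0 .. nstates-1] and initial
    state 0; besides bits it can output the constant words [v], [w] and the
    number of symbols read so far in unary. *)
Record machine : Type := Machine {
  nstates : nat;
  delta : nat -> bool -> nat * seq action;
  final : seq action
}.

Definition machine_wf (A : machine) : Prop :=
  0 < nstates A /\
  forall q b, q < nstates A -> (delta A q b).1 < nstates A.

Section Transducer.
Variables (A : machine) (v w : seq bool).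

Definition out1 (i : nat) (a : action) : seq bool :=
  match a with
  | Bit b => [:: b] | CopyV => v | CopyW => w | CopyPos => nseq i true
  end.

Definition out (i : nat) (l : seq action) : seq bool := flatten (map (out1 i) l).

Fixpoint trans_loop (q i : nat) (u : seq bool) : seq bool :=
  if u is b :: u' then
    out i (delta A q b).2 ++ trans_loop (delta A q b).1 i.+1 u'
  else [::].

Definition trans (u : seq bool) : seq bool :=
  trans_loop 0 0 u ++ out (size u) (final A).

End Transducer.

(** Register use of the transducer program: 0 is the input, 1 and 2 are [v] and
    [w], 3 is the output in reverse, 7 is scratch, 11 is the position in unary,
    and [flag q] is nonempty iff [q] is the current state.  All but the inputs
    are 3 mod 4, since the programs that produce the inputs are renamed into the
    other residue classes. *)
Definition flag (q : nat) : nat := q * 4 + 15.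

(** Each move reverses. Two reversals restore stack [r]; the single one reaching stack 3 is wanted
    there, since that stack holds the output in reverse. *)
Definition copy (r : nat) : prog := Seq (mv r [:: 7; 3]) (mv 7 [:: r]).

Definition action_prog (a : action) : prog :=
  match a with
  | Bit b => Push 3 b | CopyV => copy 1 | CopyW => copy 2 | CopyPos => copy 11
  end.

Definition actions_prog (l : seq action) : prog :=
  foldr (fun a => Seq (action_prog a)) Skip l.

Definition step_prog (A : machine) (b : bool) (q : nat) : prog :=
  Seq (actions_prog (delta A q b).2)
    (Seq (Pop (flag q)) (Push (flag (delta A q b).1) true)).

(** Each further test sits in the else branch of the previous one, so the state set by [step_prog]
    is not acted upon in the same round. *)
Definition dispatch (A : machine) (b : bool) (qs : seq nat) : prog :=
  foldr (fun q => If (Nonempty (flag q)) (step_prog A b q)) Skip qs.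

Definition loop_body (A : machine) : prog :=
  let qs := iota 0 (nstates A) in
  Seq (If (Top 0) (Seq (Pop 0) (dispatch A true qs))
                  (Seq (Pop 0) (dispatch A false qs)))
      (Push 11 true).

Definition loop (A : machine) : prog := While (Nonempty 0) (loop_body A).

Section TransducerProg.
Variables (A : machine) (v w : seq bool).

(** Here [u] is the unread input, [o] the reversed output so far, [i] the position and [q] the
    current state, stored one-hot in the flags. *)
Definition inv (u o : seq bool) (i q : nat) (s : store) : Prop :=
  [/\ s 0 = u, s 1 = v, s 2 = w & s 3 = o] /\
  [/\ s 7 = [::], s 11 = nseq i true &
      forall p, s (flag p) = if p == q then [:: true] else [::]].

Lemma flag_eq r q : r < 15 -> (r == flag q) = false /\ (flag q == r) = false.
Proof. by rewrite /flag; split; apply/eqP; lia. Qed.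

Lemma run_copy r s : r \notin [:: 3; 7] -> s 7 = [::] ->
  run_in (copy r) s (size (s r) * 11 + 2)
    (fun s' => s' =1 upd s 3 (rev (s r) ++ s 3)).
Proof.
rewrite !inE negb_or => /andP[/negPf r3 /negPf r7] s7.
rewrite (_ : _ + 2 = (size (s r) * 6).+1 + (size (s r) * 5).+1); last lia.
apply: run_in_seq.
  by apply: run_mv; rewrite // !inE r3 r7.
move=> s' E; have E7 : s' 7 = rev (s r).
  by rewrite E eq_sym r7 /= s7 cats0.
apply: run_in_weak (run_mv _ _ _) _ _.
- by rewrite inE eq_sym r7.
- by [].
- by rewrite E7 size_rev.
move=> s'' E'' x; rewrite E'' E7 revK !E !inE /upd.
have [->|x7] := eqVneq x 7; first by rewrite s7.
have [->|xr] := eqVneq x r; first by rewrite r3 cats0.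
by case: eqVneq => // ->.
Qed.

Lemma run_action a u o i q s (B : nat) :
  size v + size w + i <= B -> inv u o i q s ->
  run_in (action_prog a) s (B * 11 + 2)
    (inv u (rev (out1 v w i a) ++ o) i q).
Proof.
move=> szB Is.
have [[s0 s1 s2 s3] [s7 s11 sf]] := Is.
have H r l : r \notin [:: 3; 7] -> s r = l -> size l <= B ->
  run_in (copy r) s (B * 11 + 2) (inv u (rev l ++ o) i q).
  move=> r37 srl lB; apply: run_in_weak (run_copy r37 s7) _ _.
    by rewrite srl; lia.
  move=> s' E; split; split; rewrite ?E //= ?srl ?s3 //.
  by move=> p; rewrite E /upd (flag_eq _ _).2.
case: a => [b|||] /=; last 3 first.
- by apply: H => //; lia.
- by apply: H => //; lia.
- by apply: H => //; rewrite size_nseq; lia.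
apply: (@run_in_weak _ _ 1 _ (inv u (b :: o) i q)); [| lia | by []].
apply: run_in_push; split; split=> //; first by rewrite /upd /= s3.
by move=> p; rewrite /upd (flag_eq _ _).2.
Qed.

Lemma run_actions l u o i q s (B : nat) :
  size v + size w + i <= B -> inv u o i q s ->
  run_in (actions_prog l) s ((B * 11 + 2) * size l + 1)
    (inv u (rev (out v w i l) ++ o) i q).
Proof.
move=> szB; elim: l o s => [|a l IH] o s Is /=.
  by rewrite muln0; apply: run_in_skip.
rewrite mulnS -addnA; apply: run_in_seq; first exact: run_action Is.
move=> s' /IH H; apply: run_in_weak H _ _ => // s''.
by rewrite /out /= rev_cat -catA.
Qed.

Lemma run_step b u o i q q' s (B : nat) :
  size v + size w + i <= B -> inv u o i q s -> q' = (delta A q b).1 ->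
  run_in (step_prog A b q) s ((B * 11 + 2) * size (delta A q b).2 + 3)
    (inv u (rev (out v w i (delta A q b).2) ++ o) i q').
Proof.
move=> szB Is ->; rewrite (_ : 3 = 1 + (1 + 1)) // addnA.
apply: run_in_seq; first exact: run_actions Is.
move=> s' [[s0 s1 s2 s3] [s7 s11 sf]].
apply: (@run_in_seq _ _ _ _ _ (eq^~ (upd s' (flag q) [::]))).
  by apply: run_in_pop; rewrite (sf q) eqxx.
move=> _ ->; apply: run_in_push.
split; split; try by rewrite /upd !(flag_eq _ _).1.
move=> p; rewrite /upd; have fE p1 p2 : (flag p1 == flag p2) = (p1 == p2).
  by rewrite /flag; apply/eqP/eqP => [|->//]; lia.
by rewrite !fE !sf; case: (p == _); case: (_ == q).
Qed.

(** A crude bound on the number of actions of any single transition on [b]: the sum over all states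
    stands in for the maximum. *)
Definition cost (A : machine) (b : bool) : nat :=
  \sum_(0 <= q < nstates A) size (delta A q b).2.

Lemma run_dispatch b qs u o i q s (B : nat) :
  q \in qs ->
  size v + size w + i <= B -> inv u o i q s ->
  run_in (dispatch A b qs) s
     ((B * 11 + 2) * size (delta A q b).2 + 3 + size qs)
    (inv u (rev (out v w i (delta A q b).2) ++ o) i (delta A q b).1).
Proof.
move=> qqs szB Is; elim: qs qqs => [//|p qs IH] /=; rewrite inE addnS => qp.
apply: run_in_if; have [_ [_ _ sf]] := Is; rewrite /= sf.
have [pq|pq] := eqVneq p q.
  by rewrite pq; apply: run_in_weak (run_step szB Is erefl) _ _ => //; lia.
by apply: IH; move: qp; rewrite eq_sym (negPf pq).
Qed.

Definition loop_cost (B : nat) : nat :=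
  (B * 11 + 2) * (cost A true + cost A false) + 7 + nstates A.

Lemma run_loop u o i q s (B : nat) :
  machine_wf A -> q < nstates A ->
  size v + size w + (i + size u) <= B -> inv u o i q s ->
  run_in (loop A) s (loop_cost B * size u + 1)
    (fun s' => exists q',
       inv [::] (rev (trans_loop A v w q i u) ++ o) (i + size u) q' s').
Proof.
move=> [_ Awf].
elim: u o i q s => [|b u IH] o i q s qA szB Is.
  rewrite muln0; exists s, 1; split=> //.
    by apply: ExecWhileFalse; rewrite /=; case: Is => [[->]].
  by exists q; rewrite /= addn0.
have [[s0 s1 s2 s3] [s7 s11 sf]] := Is.
rewrite /= mulnS (_ : loop_cost B = ((loop_cost B).-1).+1); last first.
  by rewrite prednK // /loop_cost; lia.
rewrite -addnA addSn.
apply: (@run_in_while _ _ _ _ _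
   (inv u (rev (out v w i (delta A q b).2) ++ o) i.+1 (delta A q b).1)).
- by rewrite /= s0.
- apply: (@run_in_weak _ _ (((1 + ((B * 11 + 2) * size (delta A q b).2 + 3
                     + size (iota 0 (nstates A))))).+1 + 1) _
     (inv u (rev (out v w i (delta A q b).2) ++ o) i.+1 (delta A q b).1)).
  + apply: (@run_in_seq _ _ _ _ _
      (inv u (rev (out v w i (delta A q b).2) ++ o) i (delta A q b).1)).
      apply: run_in_if; rewrite /= s0.
      rewrite (_ : (if _ then _ else _) =
        Seq (Pop 0) (dispatch A b (iota 0 (nstates A)))); last by case: (b).
      apply: (@run_in_seq _ _ _ _ _ (inv u o i q)).
        apply: run_in_pop; split; split=> //; first by rewrite /upd /= s0.
        by move=> p; rewrite /upd (flag_eq _ _).2.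
      move=> s'; apply: run_dispatch; first by rewrite mem_iota.
      by move: szB => /=; lia.
    move=> s' [[t0 t1 t2 t3] [t7 t11 tf]]; apply: run_in_push.
    split; split=> //; first by rewrite /upd /= t11.
    by move=> p; rewrite /upd (flag_eq _ _).2.
  + have : size (delta A q b).2 <= cost A true + cost A false.
      have : size (delta A q b).2 <= cost A b.
        rewrite /cost (bigD1_seq q) ?iota_uniq ?mem_index_iota //=.
        exact: leq_addr.
      by case: (b); lia.
    rewrite size_iota /loop_cost => h.
    have := leq_mul (leqnn (B * 11 + 2)) h; lia.
  + by [].
move=> s' Is'; apply: run_in_weak (IH _ _ _ _ _ _ Is') _ _.
- exact: Awf.
- by move: szB => /=; lia.
- by rewrite leq_add2r leq_mul2r leqSpred orbT.
move=> s'' [q' Is'']; exists q'; rewrite addnS -addSn.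
by rewrite rev_cat -catA.
Qed.

End TransducerProg.

Definition mod4 (c r : nat) : nat := r * 4 + c.

Lemma mod4_inj c : injective (mod4 c).
Proof. by move=> r r'; rewrite /mod4; lia. Qed.

(** On the stacks of residue [c] the store looks like the initial store of [P], and stack 0 of [P]
    becomes stack [c]. Residue 3 is left to the transducer. *)
Lemma run_in_ren c (g : nat -> seq bool) P time n S : c < 3 ->
  (forall n, exists (s' : store) (k : nat),
      [/\ exec P (upd (fun=> [::]) 0 (nseq n true)) s' k,
          (k <= time n)%N & s' 0%N = g n]) ->
  (forall r, S (mod4 c r) = if r == 0 then nseq n true else [::]) ->
  size (g n) <= n + time n /\
  run_in (ren (mod4 c) P) S (time n) (fun S' =>
    S' c = g n /\ forall r, r %% 4 != c -> S' r = S r).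
Proof.
move=> c3 /(_ n)[s' [k [e kT gE]]] Sn; split.
  by rewrite -gE; apply: leq_trans (exec_size 0 e) _; rewrite /upd size_nseq leq_add2l.
have [S' [e' E' F']] := exec_ren (@mod4_inj c) e Sn.
exists S', k; split=> //; split; first by rewrite -gE -E' /= /mod4 mul0n.
by move=> r rc; apply: F' => r' rE; move/eqP: rc; apply; rewrite rE /mod4; lia.
Qed.

Lemma poly_time_size g : poly_time g -> poly_bounded (fun n => size (g n)).
Proof.
move=> [P [time [Tp H]]].
apply: poly_bounded_le (poly_boundedD poly_bounded_id Tp) _ => n.
have [s' [k [e kT <-]]] := H n; apply: leq_trans (exec_size 0 e) _.
by rewrite /upd size_nseq leq_add2l.
Qed.

(** For a fixed machine the running time is a polynomial in the lengths of the three words, which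
    are themselves polynomial in [n]. All later uniformity claims reduce to this closure
    property. *)
Theorem poly_time_trans A gu gv gw : machine_wf A ->
  poly_time gu -> poly_time gv -> poly_time gw ->
  poly_time (fun n => trans A (gv n) (gw n) (gu n)).
Proof.
move=> Awf pu pv pw.
have [[szu szv] szw] := (poly_time_size pu, poly_time_size pv, poly_time_size pw).
case: pu => [Pu [tu [Tu Hu]]]; case: pv => [Pv [tv [Tv Hv]]].
case: pw => [Pw [tw [Tw Hw]]].
pose B n := size (gv n) + size (gw n) + size (gu n).
pose L n := size (trans A (gv n) (gw n) (gu n)).
have Bp : poly_bounded B by do 2!apply: poly_boundedD => //.
pose Tl n := loop_cost A (B n) * size (gu n) + 1.
pose Tf n := (B n * 11 + 2) * size (final A) + 1.
have Tlp : poly_bounded Tl.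
  rewrite /Tl /loop_cost; do ?[exact: poly_bounded_const | exact: Bp | exact: szu |
   apply: poly_boundedD | apply: poly_boundedM].
have Tfp : poly_bounded Tf.
  rewrite /Tf; do ?[exact: poly_bounded_const | exact: Bp |
   apply: poly_boundedD | apply: poly_boundedM].
pose T0 n := (n * (1 + 4)).+1 + ((n * (3 + 4)).+1 + (tu n + (tv n + (tw n +
  (1 + (Tl n + Tf n)))))).
have T0p : poly_bounded T0.
  apply: poly_bounded_le (_ : poly_bounded (fun n => (n * 5 + 1) + ((n * 7 + 1) + (tu n + (tv n + (tw n +
  (1 + (Tl n + Tf n)))))))) _; last by move=> n; rewrite /T0; lia.
  do ?[exact: poly_bounded_const | exact: poly_bounded_id | exact: Tlp | exact: Tfp
   | exact: Tu | exact: Tv | exact: Tw |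
   apply: poly_boundedD | apply: poly_boundedM].
(* A move empties its source, so the input goes through stack 3 to reach stacks 0, 1 and 2, the
   input stacks of the three renamed programs. *)
pose P := Seq (mv 0 [:: 3]) (Seq (mv 3 [:: 0; 1; 2]) (Seq (ren (mod4 0) Pu)
  (Seq (ren (mod4 1) Pv) (Seq (ren (mod4 2) Pw) (Seq (Push (flag 0) true)
  (Seq (loop A) (actions_prog (final A)))))))).
have main n : run_in P (upd (fun=> [::]) 0 (nseq n true)) (T0 n) (fun s =>
    s 0 = [::] /\ s 3 = rev (trans A (gv n) (gw n) (gu n))).
  apply: (@run_in_seq _ _ _ _ _ (fun s => s =1 upd (fun=> [::]) 3 (nseq n true))).
    apply: run_in_weak (@run_mv 0 [:: 3] _ _ _) _ _ => //.
      by rewrite /upd size_nseq.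
    move=> s' E r; rewrite E /upd /= !inE rev_nseq.
    by case: (r =P 0) => [->//|_]; rewrite cats0.
  move=> s E; apply: (@run_in_seq _ _ _ _ _ (fun s => s =1 fun r =>
       if r < 3 then nseq n true else [::])).
    apply: run_in_weak (@run_mv 3 [:: 0; 1; 2] _ _ _) _ _ => //.
      by rewrite E /upd size_nseq.
    move=> s' E' r; rewrite E' !E /upd /= !inE rev_nseq.
    by case: r => [|[|[|[|r]]]] /=; rewrite ?cats0.
  move=> {E}s E.
  have [|su] := @run_in_ren 0 gu Pu tu n s isT Hu.
    by move=> [|r]; rewrite E /mod4 //=; case: ltnP => //; lia.
  move/run_in_seq; apply=> s1 [s1u E1].
  have [|sv] := @run_in_ren 1 gv Pv tv n s1 isT Hv.
    move=> r; rewrite E1 ?E /mod4 ?modnMDl //.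
    by case: r => [|r] //=; case: ltnP => //; lia.
  move/run_in_seq; apply=> s2 [s2v E2].
  have [|sw] := @run_in_ren 2 gw Pw tw n s2 isT Hw.
    move=> r; rewrite E2 ?E1 ?E /mod4 ?modnMDl //.
    by case: r => [|r] //=; case: ltnP => //; lia.
  move/run_in_seq; apply=> s3 [s3w E3].
  apply: (@run_in_seq _ _ _ _ _ (inv (gv n) (gw n) (gu n) [::] 0 0)).
    have F r : r %% 4 = 3 -> s3 r = [::].
      move=> r4; rewrite E3 ?E2 ?E1 ?E ?r4 //.
      by case: r r4 => [|[|[|r]]].
    apply: run_in_push; split; split; rewrite /upd /=; try exact: F.
    - by rewrite E3 // E2.
    - by rewrite E3.
    - exact: s3w.
    - have f4 p : flag p %% 4 = 3 by rewrite /flag modnMDl.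
      by move=> p; rewrite !F // /flag eqn_add2r eqn_mul2r; case: p.
  move=> s4 I4; apply: run_in_seq.
    by apply: (run_loop (B := B n) Awf _ _ I4); [case: Awf | rewrite /B; lia].
  move=> s5 [q I5]; apply: run_in_weak (run_actions (B := B n) _ _ I5) _ _ => //.
    by move=> s6 [[-> _ _ ->] _]; rewrite cats0 /trans rev_cat.
exists (Seq P (mv 3 [:: 0])), (fun n => T0 n + (L n * 5).+1); split.
  (* The last move costs as much as the output is long, and that length is bounded by the time spent
     before. *)
  apply: poly_bounded_le (_ : poly_bounded (fun n => T0 n + ((T0 n + n) * 5 + 1))) _.
    do ?[exact: poly_bounded_const | exact: poly_bounded_id | exact: T0p |
     apply: poly_boundedD | apply: poly_boundedM].
  move=> n; have [s [k [e kT [_ s3]]]] := main n.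
  have := exec_size 3 e; rewrite s3 size_rev /upd /= -/(L n); lia.
move=> n; have [|s [k [e kT s0]]] := @run_in_seq _ (mv 3 [:: 0]) _ (T0 n) (L n * 5).+1
  _ (fun s => s 0 = trans A (gv n) (gw n) (gu n)) (main n); last by exists s, k.
move=> s [s0 s3]; apply: run_in_weak (@run_mv 3 [:: 0] _ _ _) _ _ => //.
  by rewrite s3 size_rev.
by move=> s' ->; rewrite /= s3 revK s0 cats0.
Qed.

(** * Polynomial-time transformations of circuit codes *)

Lemma out_bits v w i l : out v w i (map Bit l) = l.
Proof. by rewrite /out; elim: l => //= b l ->. Qed.

Lemma poly_time_id : poly_time (nseq^~ true).
Proof.
exists Skip, (fun=> 1); split; first exact: poly_bounded_const.
by move=> n; exists (upd (fun=> [::]) 0 (nseq n true)), 1; split=> //; constructor.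
Qed.

(** It ignores its input and emits only the final word; constants and concatenations are the
    instances used. *)
Definition final_machine (l : seq action) : machine :=
  Machine 1 (fun _ _ => (0, [::])) l.

Lemma trans_final l v w u : trans (final_machine l) v w u = out v w (size u) l.
Proof.
rewrite /trans /=; suff -> : trans_loop (final_machine l) v w 0 0 u = [::] by [].
by elim: u 0 {-1}0 => //= b u IH q i; rewrite IH.
Qed.

Lemma poly_time_final l gv gw : poly_time gv -> poly_time gw ->
  poly_time (fun n => out (gv n) (gw n) n l).
Proof.
move=> pv pw; have := @poly_time_trans (final_machine l) _ _ _ _ poly_time_id pv pw.
have [->|]// := pselect ((fun n => trans (final_machine l) (gv n) (gw n) (nseq n true))
   = (fun n => out (gv n) (gw n) n l)); first by apply; split.
by case; apply/funext => n; rewrite trans_final size_nseq.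
Qed.

Lemma poly_time_ext g g' : g =1 g' -> poly_time g -> poly_time g'.
Proof. by move=> /funext ->. Qed.

Lemma poly_time_const l : poly_time (fun=> l).
Proof.
apply: poly_time_ext (poly_time_final (map Bit l) poly_time_id poly_time_id) => n.
exact: out_bits.
Qed.

Lemma poly_time_cat g h :
  poly_time g -> poly_time h -> poly_time (fun n => g n ++ h n).
Proof.
move=> pg ph; apply: poly_time_ext (poly_time_final [:: CopyV; CopyW] pg ph) => n.
by rewrite /out /= cats0.
Qed.

Local Arguments enc_nat : simpl never.

(** * Unary numbers and codes of lists computable in polynomial time *)

Definition unary_pt (c : nat -> nat) : Prop := poly_time (fun n => nseq (c n) true).

Lemma unary_pt_const c : unary_pt (fun=> c). Proof. exact: poly_time_const. Qed.

Lemma unary_ptD c d : unary_pt c -> unary_pt d -> unary_pt (fun n => c n + d n).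
Proof.
move=> pc pd; apply: poly_time_ext (poly_time_cat pc pd) => n.
by rewrite nseqD.
Qed.

Lemma unary_ptMl k c : unary_pt c -> unary_pt (fun n => k * c n).
Proof.
move=> pc; elim: k => [|k IH]; first exact: (unary_pt_const 0).
by apply: poly_time_ext (unary_ptD pc IH) => n; rewrite mulSn.
Qed.

(** The code without its terminator, so that concatenation of lists is concatenation of words. *)
Definition body (L : seq (seq nat)) : seq bool :=
  flatten [seq true :: enc_seq enc_nat l | l <- L].

Lemma enc_seqE L : enc_seq (enc_seq enc_nat) L = body L ++ [:: false].
Proof. by rewrite /body; elim: L => //= l L ->; rewrite catA. Qed.

Lemma body_cat L L' : body (L ++ L') = body L ++ body L'.
Proof. by rewrite /body map_cat flatten_cat. Qed.

Definition list_pt (L : nat -> seq (seq nat)) : Prop := poly_time (fun n => body (L n)).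

Lemma list_pt_const L : list_pt (fun=> L). Proof. exact: poly_time_const. Qed.

Lemma list_pt_cat L L' : list_pt L -> list_pt L' -> list_pt (fun n => L n ++ L' n).
Proof.
move=> pL pL'; apply: poly_time_ext (poly_time_cat pL pL') => n.
by rewrite body_cat.
Qed.

(** The list [js] does not depend on [n], so finitely many concatenations suffice and no program has
    to loop over it. *)
Lemma list_pt_flatten (F : nat -> nat -> seq (seq nat)) js :
  (forall j, list_pt (F j)) -> list_pt (fun n => flatten [seq F j n | j <- js]).
Proof.
move=> pF; elim: js => [|j js IH] /=; first exact: (list_pt_const [::]).
exact: list_pt_cat.
Qed.

(** A gate is encoded as the list of its tag and its wires; with [keep], the
    tag is left unchanged. *)
Definition shift_list (keep : bool) (B : nat) (l : seq nat) : seq nat :=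
  if keep then (if l is a :: l' then a :: map (addn B) l' else [::])
  else map (addn B) l.

(** States: 0 between lists, 1 before the head, 2 in the head, 3 before another
    entry, 4 in another entry. *)
Definition shift_machine (keep : bool) : machine :=
  Machine 5 (fun q b => match q, b with
    | 0, true => (if keep then 1 else 3, [:: Bit true])
    | 1, true => (2, [:: Bit true])
    | 2, true => (2, [:: Bit true])
    | 2, false => (3, [:: Bit false])
    | 3, true => (4, [:: Bit true; CopyV])
    | 4, true => (4, [:: Bit true])
    | 4, false => (3, [:: Bit false])
    | _, false => (0, [:: Bit false])
    | _, true => (0, [::])
    end) [::].

(** In unary, adding [B] to an entry means inserting [B] ones right after the marker that announces
    it, and the word [v] supplies these ones. *)
Lemma trans_shift keep B w L :
  trans (shift_machine keep) (nseq B true) w (body L) =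
  body (map (shift_list keep B) L).
Proof.
rewrite /trans /out /= cats0.
set T := trans_loop _ _ _.
have Tnat k r i : T 4 i (enc_nat k ++ r) = enc_nat k ++ T 3 (i + k.+1) r.
  by rewrite /enc_nat; elim: k i => [|k IH] i /=; rewrite /T /= -/T ?IH ?addn1 ?addSnnS //.
have Ttag k r i : T 2 i (enc_nat k ++ r) = enc_nat k ++ T 3 (i + k.+1) r.
  by rewrite /enc_nat; elim: k i => [|k IH] i /=; rewrite /T /= -/T ?IH ?addn1 ?addSnnS //.
have Tlist l r i : exists i', T 3 i (enc_seq enc_nat l ++ r) =
    enc_seq enc_nat (map (addn B) l) ++ T 0 i' r.
  elim: l i => [|k l IH] i /=; first by exists i.+1.
  rewrite {1}/T /= -/T cats0 -catA Tnat; have [i' ->] := IH (i.+1 + k.+1).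
  by exists i'; rewrite /enc_nat nseqD rcons_cat -!catA.
have bodyS l' L' : body (l' :: L') = true :: enc_seq enc_nat l' ++ body L' by [].
elim: L {2}0 => [//|l L IH] i; rewrite map_cons !bodyS {1}/T /= -/T.
congr cons; have [kE|kE] : keep = true \/ keep = false by case: (keep); [left|right].
  case: l => [|k l]; rewrite {1}kE /shift_list {1}kE /= {1}/T /= -/T ?IH //.
  congr cons; rewrite -!catA Ttag.
  by have [i' ->] := Tlist l (body L) (i.+2 + k.+1); rewrite IH.
rewrite {1}kE; have [i' ->] := Tlist l (body L) i.+1.
by rewrite {1}/shift_list {1}kE IH.
Qed.

Lemma list_pt_shift keep B L : unary_pt B -> list_pt L ->
  list_pt (fun n => map (shift_list keep (B n)) (L n)).
Proof.
move=> pB pL; have wf : machine_wf (shift_machine keep).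
  by split=> // -[|[|[|[|[|q]]]]] [] //= _; case: keep.
apply: poly_time_ext (poly_time_trans wf pL pB poly_time_id) => n.
exact: trans_shift.
Qed.

(** This gives circuits the format of query lists, so the same transducers serve both. *)
Definition gate_data (g : gate) : seq nat := gate_tag g :: gate_wires g.

Lemma enc_seq_gate gs : enc_seq enc_gate gs = enc_seq (enc_seq enc_nat) (map gate_data gs).
Proof. by rewrite /enc_seq foldr_map. Qed.

Definition shift_gate (B : nat) (g : gate) : gate :=
  match g with
  | GX i => GX (B + i) | GH i => GH (B + i) | GT i => GT (B + i)
  | GCNOT i j => GCNOT (B + i) (B + j)
  | GToffoli i j k => GToffoli (B + i) (B + j) (B + k)
  end.

Lemma gate_data_shift B gs :
  map gate_data (map (shift_gate B) gs) = map (shift_list true B) (map gate_data gs).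
Proof. by rewrite -!map_comp; apply: eq_map; case. Qed.

Definition cnots (cs : seq (nat * nat)) : seq gate := [seq GCNOT e.1 e.2 | e <- cs].

Definition ladder (c d len : nat) : seq (nat * nat) :=
  [seq (c + i, d + i) | i <- iota 0 len].

(** One CNOT per input symbol. The seven leading bits are the marker of a list, the marker of an
    entry, the tag 3 of [GCNOT] in unary with its end bit, and the marker of the control wire. The
    two wires are the offsets [v] and [w] plus the position. *)
Definition ladder_machine : machine :=
  Machine 1 (fun _ _ => (0, map Bit [:: true; true; true; true; true; false; true] ++
     [:: CopyV; CopyPos] ++ map Bit [:: false; true] ++ [:: CopyW; CopyPos] ++
     map Bit [:: false; false])) [::].

Lemma list_pt_ladder c d len : unary_pt c -> unary_pt d -> unary_pt len ->
  list_pt (fun n => map gate_data (cnots (ladder (c n) (d n) (len n)))).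
Proof.
move=> pc pd pl; have wf : machine_wf ladder_machine by [].
apply: poly_time_ext (poly_time_trans wf pl pc pd) => n.
rewrite /trans /out /= cats0 /ladder.
have H l : forall i, trans_loop ladder_machine (nseq (c n) true) (nseq (d n) true) 0 i
    (nseq l true) =
    body (map gate_data (cnots [seq (c n + j, d n + j) | j <- iota i l])).
  elim: l => //= l IH i; rewrite IH /body /= /enc_seq /= /enc_nat.
  by rewrite /out /= -!cats1 !nseqD /= -!catA.
exact: H.
Qed.

(** Scans the code of a circuit: state 0 reads the number of ancillas; section
    [s] (0: first circuit, 1: queries, 2: second circuit) uses the states
    [3 s + 1] (between lists), [3 s + 2] (in a list), [3 s + 3] (in a number). *)
Definition scan_machine (em : nat -> bool -> seq bool) : machine :=
  Machine 11 (fun q b => (match q, b with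
    | 0, true => 0 | 0, false => 1
    | 1, true => 2 | 1, false => 4 | 2, true => 3 | 2, false => 1
    | 3, true => 3 | 3, false => 2
    | 4, true => 5 | 4, false => 7 | 5, true => 6 | 5, false => 4
    | 6, true => 6 | 6, false => 5
    | 7, true => 8 | 7, false => 10 | 8, true => 9 | 8, false => 7
    | 9, true => 9 | 9, false => 8
    | _, _ => 10
    end, map Bit (em q b))) [::].

Section Scan.
Variable em : nat -> bool -> seq bool.

Definition scan_nat (q k : nat) : seq bool := flatten (nseq k (em q true)) ++ em q false.

Definition scan_list (q : nat) (l : seq nat) : seq bool :=
  flatten [seq em q true ++ scan_nat q.+1 k | k <- l] ++ em q false.

Definition scan_section (q : nat) (L : seq (seq nat)) : seq bool :=
  flatten [seq em q true ++ scan_list q.+1 l | l <- L] ++ em q false.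

Lemma scan_list_cons q k l :
  scan_list q (k :: l) = em q true ++ scan_nat q.+1 k ++ scan_list q l.
Proof. by rewrite /scan_list /= -!catA. Qed.

Lemma scan_section_cons q l L :
  scan_section q (l :: L) = em q true ++ scan_list q.+1 l ++ scan_section q L.
Proof. by rewrite /scan_section /= -!catA. Qed.

(** The code is self-delimiting with bounded nesting depth, so a finite control can parse it. By the
    numbering of states, the end of a number or of an inner list leads from [q] to [q.-1], and the
    end of a section from [q] to [q + 3]. *)
Lemma trans_scan v w V : trans (scan_machine em) v w (enc_vcircuit V) =
  scan_nat 0 (vanc V) ++ scan_section 1 (map gate_data (vpre V)) ++
  scan_section 4 (vqueries V) ++ scan_section 7 (map gate_data (vpost V)).
Proof.
rewrite /trans [X in _ ++ X]/out /= cats0 /enc_vcircuit !enc_seq_gate.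
set T := trans_loop _ _ _.
have T0 k r i : exists i', T 0 i (enc_nat k ++ r) = scan_nat 0 k ++ T 1 i' r.
  elim: k i => [|k IH] i; rewrite {1}/T /= out_bits -/T; first by exists i.+1.
  by have [i' ->] := IH i.+1; exists i'; rewrite /scan_nat /= !catA.
have Tnat q k r i : q \in [:: 3; 6; 9] ->
    exists i', T q i (enc_nat k ++ r) = scan_nat q k ++ T q.-1 i' r.
  move=> qs; elim: k i => [|k IH] i; rewrite {1}/T /= out_bits -/T.
    by exists i.+1; move: qs; rewrite !inE => /or3P[] /eqP->.
  have [i' E] := IH i.+1; exists i'; rewrite /scan_nat /= -!catA.
  congr (_ ++ _); rewrite catA -[RHS]E; move: qs.
  by rewrite !inE => /or3P[] /eqP->.
have Tlist q l r i : q \in [:: 2; 5; 8] ->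
    exists i', T q i (enc_seq enc_nat l ++ r) = scan_list q l ++ T q.-1 i' r.
  move=> qs; elim: l i => [|k l IH] i; rewrite {1}/T /= out_bits -/T.
    by exists i.+1; move: qs; rewrite !inE => /or3P[] /eqP->.
  have qs1 : q.+1 \in [:: 3; 6; 9] by move: qs; rewrite !inE !eqSS.
  rewrite -catA; have [i1 E1] := Tnat _ k (enc_seq enc_nat l ++ r) i.+1 qs1.
  have [i' E] := IH i1; exists i'.
  rewrite scan_list_cons -[RHS]catA -[X in _ = _ ++ X]catA -E -E1; congr (_ ++ _).
  by move: qs; rewrite !inE => /or3P[] /eqP->.
have Tsec q L r i : q \in [:: 1; 4; 7] ->
    exists i', T q i (enc_seq (enc_seq enc_nat) L ++ r) = scan_section q L ++ T (q + 3) i' r.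
  move=> qs; elim: L i => [|l L IH] i; rewrite {1}/T /= out_bits -/T.
    by exists i.+1; move: qs; rewrite !inE => /or3P[] /eqP->.
  have qs1 : q.+1 \in [:: 2; 5; 8] by move: qs; rewrite !inE !eqSS.
  rewrite -catA; have [i1 E1] := Tlist _ l (enc_seq (enc_seq enc_nat) L ++ r) i.+1 qs1.
  have [i' E] := IH i1; exists i'.
  rewrite scan_section_cons -[RHS]catA -[X in _ = _ ++ X]catA -E -E1; congr (_ ++ _).
  by move: qs; rewrite !inE => /or3P[] /eqP->.
have [i1 ->] := T0 (vanc V) (enc_seq (enc_seq enc_nat) (map gate_data (vpre V)) ++
  enc_seq (enc_seq enc_nat) (vqueries V) ++ enc_seq (enc_seq enc_nat) (map gate_data (vpost V))) 0.
have [//|i2 ->] := Tsec 1 (map gate_data (vpre V)) (enc_seq (enc_seq enc_nat) (vqueries V) ++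
  enc_seq (enc_seq enc_nat) (map gate_data (vpost V))) i1.
have [//|i3 ->] := Tsec 4 (vqueries V) (enc_seq (enc_seq enc_nat) (map gate_data (vpost V))) i2.
have [//|i4] := Tsec 7 (map gate_data (vpost V)) [::] i3.
by rewrite cats0 => ->; rewrite /T /= cats0.
Qed.
End Scan.

Lemma flatten_nil (T U : Type) (f : T -> seq U) s :
  (forall x, f x = [::]) -> flatten (map f s) = [::].
Proof. by move=> f0; elim: s => //= x s ->; rewrite f0. Qed.

Lemma scan_silent em q L : (forall d b, d < 3 -> em (q + d) b = [::]) ->
  scan_section em q L = [::].
Proof.
move=> e; rewrite /scan_section.
have e0 b : em q b = [::] by rewrite -(e 0 b) ?addn0.
have e1 b : em q.+1 b = [::] by rewrite -(e 1 b) ?addn1.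
have e2 b : em q.+2 b = [::] by rewrite -(e 2 b) ?addn2.
rewrite flatten_nil ?e0 // => l; rewrite /scan_list flatten_nil ?e1 // => k.
by rewrite /scan_nat !e2 cats0; elim: k.
Qed.

Lemma scan_copy em q L :
  (forall b, em q.+2 b = [:: b]) -> (forall b, em q.+1 b = [:: b]) ->
  em q true = [:: true] -> em q false = [::] -> scan_section em q L = body L.
Proof.
move=> e2 e1 e0 e0'; rewrite /scan_section e0 e0' cats0; congr flatten.
apply: eq_map => l /=; congr cons; rewrite /scan_list !e1.
elim: l => //= k l IH; rewrite -catA IH; congr cons; congr cat.
by rewrite /scan_nat !e2 /enc_nat -cats1; congr cat; elim: k => //= k ->.
Qed.

(** * Recovering the components of a circuit from its code *)

Section Extract.
Variable V : nat -> vcircuit.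
Hypothesis Vpt : poly_time_family V.

Lemma poly_time_scan em (g : nat -> seq bool) :
  (forall n, trans (scan_machine em) [::] [::] (enc_vcircuit (V n)) = g n) -> poly_time g.
Proof.
move=> E; have wf : machine_wf (scan_machine em).
  by split=> // q b; do 11![case: q => [|q]; first by case: b].
have pn := poly_time_const [::].
exact: poly_time_ext (poly_time_trans wf Vpt pn pn).
Qed.

Lemma unary_pt_vanc : unary_pt (fun n => vanc (V n)).
Proof.
apply: (@poly_time_scan (fun q b => if (q == 0) && b then [:: true] else [::])) => n.
rewrite trans_scan !scan_silent // !cats0 /scan_nat /= cats0.
by elim: (vanc _) => //= k ->.
Qed.

Lemma unary_pt_queries : unary_pt (fun n => size (vqueries (V n))).
Proof.
apply: (@poly_time_scan (fun q b => if (q == 4) && b then [:: true] else [::])) => n.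
rewrite trans_scan [scan_section _ 1 _]scan_silent; last by case=> [|[|[|]]].
rewrite [scan_section _ 7 _]scan_silent; last by case=> [|[|[|]]].
rewrite /scan_nat /= !cats0 (_ : flatten (nseq _ _) = [::]) ?cat0s; last first.
  by elim: (vanc _) => //= k ->.
rewrite /scan_section /= cats0; elim: (vqueries _) => //= l L ->.
rewrite /scan_list cats0 flatten_nil // => k.
by rewrite /scan_nat /= cats0; elim: k => //= k ->.
Qed.

(** Echoes one section except its closing [false], which [body] leaves out. *)
Let section_em q0 q b := if (q0 <= q < q0 + 3) && ((q0 < q) || b) then [:: b] else [::].

Lemma list_pt_section q0 : q0 \in [:: 1; 4; 7] ->
  list_pt (fun n => if q0 == 1 then map gate_data (vpre (V n)) else
                    if q0 == 4 then vqueries (V n) else map gate_data (vpost (V n))).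
Proof.
move=> q0s; apply: (@poly_time_scan (section_em q0)) => n.
rewrite trans_scan (_ : scan_nat _ _ _ = [::]) ?cat0s; last first.
  move: q0s; rewrite !inE => /or3P[] /eqP-> /=; rewrite /scan_nat /= cats0;
  by elim: (vanc _) => //= k ->.
move: q0s; rewrite !inE => /or3P[] /eqP-> /=;
  [rewrite [scan_section _ 1 _]scan_copy //| rewrite [scan_section _ 4 _]scan_copy //
  | rewrite [scan_section _ 7 _]scan_copy //];
  by rewrite !scan_silent ?cats0 //; case=> [|[|[|]]].
Qed.

Lemma list_pt_vpre : list_pt (fun n => map gate_data (vpre (V n))).
Proof. exact: (@list_pt_section 1). Qed.

Lemma list_pt_queries : list_pt (fun n => vqueries (V n)).
Proof. exact: (@list_pt_section 4). Qed.

Lemma list_pt_vpost : list_pt (fun n => map gate_data (vpost (V n))).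
Proof. exact: (@list_pt_section 7). Qed.
End Extract.

Lemma poly_time_family_of W : unary_pt (fun n => vanc (W n)) ->
  list_pt (fun n => map gate_data (vpre (W n))) ->
  list_pt (fun n => vqueries (W n)) ->
  list_pt (fun n => map gate_data (vpost (W n))) -> poly_time_family W.
Proof.
have pf := poly_time_const [:: false].
move=> pa p1 p2 p3; rewrite /poly_time_family.
apply: poly_time_ext (poly_time_cat (poly_time_cat pa pf)
  (poly_time_cat (poly_time_cat p1 pf) (poly_time_cat (poly_time_cat p2 pf)
     (poly_time_cat p3 pf)))) => n.
by rewrite /enc_vcircuit !enc_seq_gate !enc_seqE /enc_nat -cats1.
Qed.

(** * Windows of wires and classical circuits *)

Lemma eq_from_nth_tuple m (b c : m.-tuple bool) :
  (forall i, i < m -> nth false b i = nth false c i) -> b = c.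
Proof.
by move=> bc; apply: val_inj; apply: (@eq_from_nth _ false); rewrite !size_tuple.
Qed.

Definition window (M B : nat) (b : seq bool) : M.-tuple bool :=
  [tuple nth false b (B + i) | i < M].

Lemma nth_window M B b i : i < M -> nth false (window M B b) i = nth false b (B + i).
Proof.
by move=> iM; rewrite -[X in nth _ _ X]/(nat_of_ord (Ordinal iM)) -tnth_nth tnth_mktuple.
Qed.

Lemma window_window M B K A b : A + K <= M ->
  window K A (window M B b) = window K (B + A) b.
Proof.
move=> AKM; apply: eq_from_nth_tuple => i iK.
by rewrite !nth_window ?addnA //; lia.
Qed.

Lemma window_id m (b : m.-tuple bool) : window m 0 b = b.
Proof. by apply: eq_from_nth_tuple => i im; rewrite nth_window. Qed.

Lemma window_catl M B b c : B + M <= size b -> window M B (b ++ c) = window M B b.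
Proof.
move=> h; apply: eq_from_nth_tuple => i iM; rewrite !nth_window // nth_cat.
by rewrite (_ : _ < _) //; lia.
Qed.

Lemma window_catr M K B b c : size b = K ->
  window M (K + B) (b ++ c) = window M B c.
Proof.
move=> <-; apply: eq_from_nth_tuple => i iM; rewrite !nth_window // nth_cat -addnA.
by rewrite ltnNge leq_addr addKn.
Qed.

Lemma nth_flip m i (b : m.-tuple bool) j : j < m ->
  nth false (flip i b) j = nth false b j (+) (j == i).
Proof.
move=> jm; rewrite -[j]/(nat_of_ord (Ordinal jm)) -!tnth_nth tnth_mktuple.
by [].
Qed.

Lemma window_flip L M B i (b : L.-tuple bool) : B + M <= L -> i < M ->
  window M B (flip (B + i) b) = flip i (window M B b).
Proof.
move=> BML iM; apply: eq_from_nth_tuple => j jM.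
by rewrite nth_flip // !nth_window // nth_flip ?eqn_add2l //; lia.
Qed.

Lemma window_flip_out L M B i (b : L.-tuple bool) : B + M <= L ->
  (i < B) || (B + M <= i) -> window M B (flip i b) = window M B b.
Proof.
move=> BML iout; apply: eq_from_nth_tuple => j jM; rewrite !nth_window // nth_flip; last lia.
by rewrite (_ : (_ == i) = false) ?addbF //; apply/eqP; lia.
Qed.

Lemma flipK m i : involutive (@flip m i).
Proof.
move=> b; apply: eq_from_nth_tuple => j jm.
by rewrite !nth_flip // -addbA addbb addbF.
Qed.

(** The summand is a function of the underlying list, which avoids casts between tuples whose
    lengths are only provably equal. *)
Lemma sum_tuple_cast (V : nmodType) L L' (F : seq bool -> V) : L = L' ->
  (\sum_(b : L.-tuple bool) F b = \sum_(b : L'.-tuple bool) F b)%R.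
Proof. by move->. Qed.

Lemma sum_tuple_cat (V : nmodType) m n (F : seq bool -> V) :
  (\sum_(b : (m + n).-tuple bool) F b =
   \sum_(c : m.-tuple bool) \sum_(d : n.-tuple bool) F (c ++ d))%R.
Proof.
rewrite pair_big /=.
pose h (p : m.-tuple bool * n.-tuple bool) := cat_tuple p.1 p.2.
rewrite (reindex h) //; exists (fun b : (m + n).-tuple bool => (window m 0 b, window n m b)) => [[c d] _|b _] /=.
  congr pair; first by rewrite window_catl ?size_tuple // window_id.
  by rewrite -{1}[m]addn0 window_catr ?size_tuple // window_id.
apply: eq_from_nth_tuple => i imn; rewrite nth_cat size_tuple.
case: ltnP => im; rewrite nth_window ?subnKC //; lia.
Qed.

(** Distributivity, by splitting off the first window. It is the form in which independence of the
    copies is used. *)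
Lemma sum_windows (V : comNzRingType) t M r (f : nat -> M.-tuple bool -> V)
    (g : r.-tuple bool -> V) :
  (\sum_(b : (t * M + r).-tuple bool)
     (\prod_(j < t) f j (window M (j * M) b)) * g (window r (t * M) b) =
   (\prod_(j < t) \sum_(c : M.-tuple bool) f j c) * \sum_(d : r.-tuple bool) g d)%R.
Proof.
elim: t f => [|t IH] f.
  rewrite big_ord0 mul1r; apply: eq_bigr => b _.
  by rewrite big_ord0 mul1r; congr g; exact: (@window_id r b).
pose F (b : seq bool) := ((\prod_(j < t.+1) f j (window M (j * M) b)) *
   g (window r (t.+1 * M) b))%R.
rewrite (@sum_tuple_cast _ _ (M + (t * M + r)) F); last by rewrite mulSn addnA.
rewrite sum_tuple_cat big_ord_recl /= -mulrA -(IH (fun j => f j.+1)) mulr_suml; apply: eq_bigr => c _.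
rewrite mulr_sumr; apply: eq_bigr => d _; rewrite /F big_ord_recl /= mul0n.
rewrite window_catl ?size_tuple // window_id -mulrA; congr (_ * (_ * _))%R.
  apply: eq_bigr => j _; rewrite /bump /= add1n mulSn.
  by rewrite window_catr // size_tuple.
by rewrite mulSn window_catr // size_tuple.
Qed.

(** * Classical gates as involutions of the basis, and reversible evaluation of thresholds *)

Definition classical (g : gate) : bool :=
  match g with GH _ | GT _ => false | _ => true end.

Definition act (m : nat) (g : gate) (b : m.-tuple bool) : m.-tuple bool :=
  let bit := nth false b in
  match g with
  | GX i => flip i b
  | GCNOT i j => if bit i then flip j b else b
  | GToffoli i j k => if bit i && bit j then flip k b else b
  | _ => b
  end.

Definition fwd (m : nat) (gs : seq gate) (b : m.-tuple bool) : m.-tuple bool :=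
  foldl (fun c g => act g c) b gs.

(** The same action on assignments to all natural numbers: without a fixed number of wires, circuits
    can be shifted and extended freely. *)
Definition act_env (g : gate) (e : nat -> bool) : nat -> bool :=
  match g with
  | GX i => fun p => e p (+) (p == i)
  | GCNOT i j => fun p => e p (+) (e i && (p == j))
  | GToffoli i j k => fun p => e p (+) (e i && e j && (p == k))
  | _ => e
  end.

Definition fwd_env (gs : seq gate) (e : nat -> bool) : nat -> bool :=
  foldl (fun e g => act_env g e) e gs.

Lemma fwd_env_cat gs hs e : fwd_env (gs ++ hs) e = fwd_env hs (fwd_env gs e).
Proof. exact: foldl_cat. Qed.

Lemma nth_act m g (b : m.-tuple bool) : gate_wf m g ->
  nth false (act g b) = act_env g (nth false b).
Proof.
move=> wf; apply/funext => p.
have out c : m <= p -> nth false (c : m.-tuple bool) p = false.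
  by move=> mp; rewrite nth_default ?size_tuple.
have H i (c : m.-tuple bool) : i < m -> nth false (flip i c) p = nth false c p (+) (p == i).
  move=> im; case: (ltnP p m) => pm; first exact: nth_flip.
  by rewrite !out // (_ : (p == i) = false) //; apply/eqP; lia.
case: g wf => [i|i|i|i j|i j k] //=; rewrite /gate_wf /=.
- by rewrite andbT => im; rewrite H.
- by move=> /andP[_ /and3P[im jm _]]; case: ifP => ? //=; rewrite ?H ?addbF.
- move=> /andP[_ /and4P[_ _ km _]].
  by case: ifP => ? //=; rewrite ?H ?addbF.
Qed.

Lemma nth_fwd m gs (b : m.-tuple bool) : all (gate_wf m) gs ->
  nth false (fwd gs b) = fwd_env gs (nth false b).
Proof.
elim: gs b => //= g gs IH b /andP[wf wfs].
by rewrite IH // nth_act.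
Qed.

Lemma actK m g : gate_wf m g -> involutive (@act m g).
Proof.
move=> wf b; apply: eq_from_nth_tuple => p pm; rewrite !nth_act //.
case: g wf => [i|i|i|i j|i j k] //=; rewrite /gate_wf /= ?inE.
- by rewrite -addbA addbb addbF.
- rewrite !andbT => /andP[/negPf-> _]; rewrite andbF addbF.
  by rewrite -addbA addbb addbF.
- rewrite !andbT negb_or => /andP[/andP[/andP[_ /negPf->] /negPf->] _].
  by rewrite !andbF !addbF -addbA addbb addbF.
Qed.

Lemma fwd_env_shift_lt B gs e p : p < B ->
  fwd_env (map (shift_gate B) gs) e p = e p.
Proof.
move=> pB; elim: gs e => //= g gs IH e; rewrite IH.
have E i : (p == B + i) = false by apply/eqP; lia.
by case: g => [i|i|i|i j|i j k] //=; rewrite E ?andbF addbF.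
Qed.

Lemma fwd_env_shift B gs e p :
  fwd_env (map (shift_gate B) gs) e (B + p) = fwd_env gs (fun p => e (B + p)) p.
Proof.
elim: gs e => //= g gs IH e; rewrite IH; congr (fwd_env _ _ _).
by apply/funext => q; case: g => [i|i|i|i j|i j k] //=; rewrite eqn_add2l.
Qed.

(** Scratch wires are those from [F] on; [t] is the number of input wires. *)
Definition computable (t : nat) (f : (nat -> bool) -> bool) : Prop :=
  (forall e e', (forall p, p < t -> e p = e' p) -> f e = f e') /\
  forall F, t <= F -> exists G F', [/\ F < F',
    all (fun g => classical g && gate_wf F' g) G &
    forall e, (forall p, F <= p < F' -> e p = false) ->
      fwd_env G e F'.-1 = f e /\
      forall p, ~~ (F <= p < F') -> fwd_env G e p = e p].

Lemma gate_wfW m m' g : m <= m' -> gate_wf m g -> gate_wf m' g.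
Proof.
move=> mm /andP[u /allP a]; apply/andP; split=> //; apply/allP => i /a im.
exact: leq_trans im mm.
Qed.

Lemma computable_bit t j : j < t -> computable t (fun e => e j).
Proof.
move=> jt; split=> [e e'|F tF]; first exact.
exists [:: GCNOT j F], F.+1; split=> //.
  by rewrite /= /gate_wf /= inE; apply/andP; split; [apply/andP; split|]; lia.
move=> e e0; split=> /= [|p pF]; first by rewrite e0 ?eqxx ?andbT //; lia.
by rewrite (_ : (p == F) = false) ?andbF ?addbF //; apply/eqP; lia.
Qed.

Lemma computable_true t : computable t xpredT.
Proof.
split=> // F tF; exists [:: GX F], F.+1; split=> //.
  by rewrite /= /gate_wf /= ltnS leqnn.
move=> e e0; split=> /= [|p pF]; first by rewrite e0 ?eqxx //; lia.
by rewrite (_ : (p == F) = false) ?addbF //; apply/eqP; lia.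
Qed.

(** [f] and [g] are evaluated on consecutive scratch ranges and [op] of the two results goes to the
    fresh wire after them. Scratch is not uncomputed: classical gates only permute the basis states
    over which probabilities are summed. *)
Lemma computable_comp2 t f g op (H : nat -> nat -> nat -> seq gate) :
  (forall i j k, i < j < k -> all (fun g => classical g && gate_wf k.+1 g) (H i j k) /\
     forall e p, fwd_env (H i j k) e p = e p (+) (op (e i) (e j) && (p == k))) ->
  computable t f -> computable t g -> computable t (fun e => op (f e) (g e)).
Proof.
move=> HP [fP fc] [gP gc]; split=> [e e' ee|F tF]; first by rewrite (fP e e') ?(gP e e').
have [G1 [F1 [F1P wf1 E1]]] := fc F tF.
have [|G2 [F2 [F2P wf2 E2]]] := gc F1; first lia.
have [|wf3 E3] := HP F1.-1 F2.-1 F2; first lia.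
exists (G1 ++ G2 ++ H F1.-1 F2.-1 F2), F2.+1; split; first lia.
  rewrite !all_cat wf3 andbT; apply/andP; split.
    by apply: sub_all wf1 => h /andP[-> /gate_wfW]; apply; lia.
  by apply: sub_all wf2 => h /andP[-> /gate_wfW]; apply; lia.
move=> e e0; rewrite !fwd_env_cat.
have [|r1 o1] := E1 e; first by move=> p pF; apply: e0; lia.
have [|r2 o2] := E2 (fwd_env G1 e).
  by move=> p pF; rewrite o1 ?e0 //; lia.
have E p : fwd_env (H F1.-1 F2.-1 F2) (fwd_env G2 (fwd_env G1 e)) p =
    fwd_env G2 (fwd_env G1 e) p (+) (op (f e) (g e) && (p == F2)).
  rewrite E3 r2 (o2 F1.-1) ?r1; last lia.
  by congr (_ (+) (op _ _ && _)); apply: gP => q qt; apply: o1; lia.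
split=> [|p pF]; rewrite E /= ?eqxx ?andbT.
  by rewrite o2 ?o1 ?e0 //; lia.
rewrite (_ : (p == F2) = false) ?andbF ?addbF; last by apply/eqP; lia.
by rewrite o2 ?o1 //; lia.
Qed.

Lemma computable_and t f g :
  computable t f -> computable t g -> computable t (fun e => f e && g e).
Proof.
apply: (@computable_comp2 t f g andb (fun i j k => [:: GToffoli i j k])) => i j k ijk.
by split=> //=; rewrite /gate_wf /= !inE; lia.
Qed.

Lemma computable_xor t f g :
  computable t f -> computable t g -> computable t (fun e => f e (+) g e).
Proof.
apply: (@computable_comp2 t f g addb (fun i j k => [:: GCNOT i k; GCNOT j k])) => i j k ijk.
split=> /= [|e p]; first by rewrite /gate_wf /= !inE; lia.
have -> : (j == k) = false by apply/eqP; lia.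
by rewrite andbF addbF; case: (p == k); rewrite ?andbF ?addbF // !andbT addbA.
Qed.

Lemma computable_ext t f g : f =1 g -> computable t f -> computable t g.
Proof. by move=> /funext->. Qed.

(** Case distinction on the last vote. The two cases exclude each other, so exclusive or serves as
    disjunction. The two recursive calls make the circuit exponential in [k], which is harmless for
    constant [t]. *)
Lemma computable_threshold t k i : k <= t ->
  computable t (fun e => i <= \sum_(j < k) e j).
Proof.
elim: k i => [|k IH] [|i] kt.
- exact: computable_true.
- apply: computable_ext (computable_xor (computable_true t) (computable_true t)) => e.
  by rewrite big_ord0.
- exact: computable_true.
have cb := @computable_bit t k kt; have kt' := ltnW kt.
apply: computable_ext (computable_xor (computable_and cb (IH i kt'))
  (computable_and (computable_xor (computable_true t) cb) (IH i.+1 kt'))) => e.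
rewrite big_ord_recr /=; case: (e k) => /=; rewrite ?addbF.
  by rewrite addn1 ltnS.
by rewrite addn0.
Qed.

(** * Norms and product states *)

Local Open Scope ring_scope.

Section Amplitudes.
Variable R : realType.
Local Notation C := R[i].

Lemma sqmodM (x y : C) : sqmod (x * y) = sqmod x * sqmod y.
Proof. by case: x y => [a b] [c d]; rewrite /sqmod /=; ring. Qed.

Lemma sqmod0 : sqmod (0 : C) = 0.
Proof. by rewrite /sqmod /=; ring. Qed.

Lemma sqmod_nat (b : bool) : sqmod (b%:R : C) = b%:R.
Proof. by case: b; rewrite ?sqmod0 // /sqmod /=; ring. Qed.

Lemma sqmod_ge0 (x : C) : 0 <= sqmod x.
Proof. by rewrite addr_ge0 // sqr_ge0. Qed.

Lemma sqmod_prod (t : nat) (F : 'I_t -> C) :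
  sqmod (\prod_j F j) = \prod_j sqmod (F j).
Proof.
by apply: (big_morph (fun x : C => sqmod x) sqmodM); rewrite -[1]/(true%:R) sqmod_nat.
Qed.

Lemma run_cat m gs hs (psi : state R m) : run (gs ++ hs) psi = run hs (run gs psi).
Proof. exact: foldl_cat. Qed.

Lemma apply_classical m g (psi : state R m) : classical g ->
  apply_gate g psi = fun b => psi (act g b).
Proof. by case: g. Qed.

(** A classical circuit permutes the basis, so an event after it is an event before it. *)
Lemma sum_run_classical m gs (psi : state R m) (P : pred (m.-tuple bool)) :
  all (fun g => classical g && gate_wf m g) gs ->
  \sum_(b | P b) sqmod (run gs psi b) = \sum_(b | P (fwd gs b)) sqmod (psi b).
Proof.
elim: gs psi => [//|g gs IH] psi /= /andP[/andP[cg wfg] wfs].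
rewrite IH // apply_classical // (reindex_inj (inv_inj (actK wfg))) /=.
by apply: eq_bigr => b _; rewrite actK.
Qed.

Lemma sqmod_sqrt2 (z : C) : sqmod (z / (Num.sqrt 2)%:C%C) = sqmod z / 2.
Proof.
have s2 : (Num.sqrt 2 : R) ^+ 2 = 2 by rewrite sqr_sqrtr.
have s0 : (Num.sqrt 2 : R) != 0 by rewrite sqrtr_eq0 -ltNge.
have -> : z / (Num.sqrt 2)%:C%C = z * ((Num.sqrt 2)^-1)%:C%C by rewrite fmorphV.
rewrite sqmodM; congr (_ * _); rewrite /sqmod /= expr0n addr0.
by rewrite exprVn s2.
Qed.

(** The real part of [z] times the conjugate of [w], the cross term in the squared modulus of a
    sum. *)
Definition dot (z w : C) : R :=
  complex.Re z * complex.Re w + complex.Im z * complex.Im w.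

Lemma sqmod_hadamard (s : bool) (z w : C) :
  sqmod (((-1) ^+ s * z + w) / (Num.sqrt 2)%:C%C) =
  (sqmod z + sqmod w + 2 * ((-1) ^+ s * dot z w)) / 2.
Proof.
rewrite sqmod_sqrt2; congr (_ / _); case: z w => [a b] [c d].
by case: s; rewrite ?expr1 ?expr0 ?mulN1r ?mul1r /sqmod /dot /=; ring.
Qed.

Lemma norm_apply m g (psi : state R m) : gate_wf m g ->
  \sum_b sqmod (apply_gate g psi b) = \sum_b sqmod (psi b).
Proof.
move=> wf; case cg: (classical g).
  rewrite apply_classical //.
  by rewrite [RHS](reindex_inj (inv_inj (actK wf))).
have flip_inj i : injective (@flip m i) by exact: inv_inj (@flipK m i).
case: g wf cg => // i; rewrite /gate_wf /= andbT => im _.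
  rewrite (eq_bigr _ (fun b _ => sqmod_hadamard _ _ _)) -mulr_suml big_split big_split /=.
    have <- : \sum_b sqmod (psi b) = \sum_b sqmod (psi (flip i b)).
    by rewrite [LHS](reindex_inj (flip_inj i)).
  rewrite -mulr_sumr.
  (* The cross terms of a Hadamard gate at [b] and at [flip i b] have opposite signs, while [dot] is
     symmetric. *)
  set X := (X in 2 * X); suff -> : X = 0 by rewrite mulr0; field.
  suff : X = - X by lra.
  rewrite {1}/X (reindex_inj (flip_inj i)) /= -sumrN; apply: eq_bigr => b _.
  rewrite flipK nth_flip // eqxx addbT signrN mulNr; congr (- (_ * _)).
  by rewrite /dot; ring.
apply: eq_bigr => b _; rewrite sqmodM -[RHS]mul1r; congr (_ * _).
case: (nth _ _ _); rewrite ?expr1 ?expr0; last by rewrite -[X in sqmod X]/(true%:R) sqmod_nat.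
by rewrite sqmod_sqrt2 /sqmod /=; field.
Qed.

Lemma norm_run m gs (psi : state R m) : all (gate_wf m) gs ->
  \sum_b sqmod (run gs psi b) = \sum_b sqmod (psi b).
Proof.
elim: gs psi => //= g gs IH psi /andP[wf wfs].
by rewrite IH // norm_apply.
Qed.

Lemma norm_ket m (w : m.-tuple bool) : \sum_b sqmod (@ket R m w b) = 1.
Proof.
rewrite (bigD1 w) //= big1 ?addr0 => [|b bw]; first by rewrite /ket eqxx sqmod_nat.
by rewrite /ket val_eqE (negPf bw) sqmod0.
Qed.

Lemma norm_project m ws (psi : state R m) :
  \sum_(o : (size ws).-tuple bool) \sum_b sqmod (project ws o psi b) =
  \sum_b sqmod (psi b).
Proof.
rewrite exchange_big /=; apply: eq_bigr => b _.
have sz : size [seq nth false b i | i <- ws] == size ws by rewrite size_map.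
rewrite (bigD1 (Tuple sz)) //= big1 ?addr0 => [|o ob]; first by rewrite /project eqxx.
rewrite /project; case: eqP => [E|_]; last exact: sqmod0.
by case/eqP: ob; apply: val_inj; rewrite /= E.
Qed.

Lemma supply_cat m k (a : seq bool) (psi : state R m) (b : (m + k).-tuple bool)
    (c : m.-tuple bool) (d : k.-tuple bool) : b = c ++ d :> seq bool ->
  supply a psi b = (val d == a)%:R * psi c.
Proof.
move=> bE; rewrite /supply bE drop_size_cat ?size_tuple //.
have -> : [tuple nth false (c ++ d) i | i < m] = c.
  by rewrite -[RHS]window_id -(@window_catl m 0 c d) ?size_tuple.
by case: eqP => _; rewrite ?mul1r ?mul0r.
Qed.

Lemma norm_supply m k (a : k.-tuple bool) (psi : state R m) :
  \sum_(b : (m + k).-tuple bool) sqmod (supply a psi b) = \sum_b sqmod (psi b).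
Proof.
pose F (b : seq bool) := sqmod ((drop m b == a)%:R * psi (window m 0 b)).
rewrite (eq_bigr (fun b : (m + k).-tuple bool => F b)) => [|b _]; last first.
  rewrite (@supply_cat _ _ _ _ _ (window m 0 b) (window k m b)); last first.
    apply: (@eq_from_nth _ false) => [|i]; rewrite ?size_cat !size_tuple // => imk.
    rewrite nth_cat size_tuple; case: ltnP => im; rewrite nth_window ?subnKC //; lia.
  rewrite /F; congr (sqmod (_%:R * _)); congr (_ == _).
  apply: (@eq_from_nth _ false) => [|i]; rewrite size_tuple ?size_drop ?size_tuple ?addKn //.
  by move=> ik; rewrite nth_window // nth_drop.
rewrite sum_tuple_cat; apply: eq_bigr => c _.
rewrite (bigD1 a) //= big1 ?addr0 => [|d da]; rewrite /F drop_size_cat ?size_tuple //.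
  by rewrite eqxx mul1r window_catl ?size_tuple // window_id.
by rewrite val_eqE (negPf da) mul0r sqmod0.
Qed.

Lemma size_bits_read V y (o : (size (flatten (vqueries V))).-tuple bool) :
  size (bits_read V y o) == size (vqueries V).
Proof.
rewrite size_map -[X in X == _](size_map size) -/(shape _) reshapeKl ?size_map //.
by rewrite size_tuple size_flatten.
Qed.

(** Gates preserve the norm, the outcomes of the index measurement split it, and supplied basis bits
    leave it unchanged. *)
Lemma total_prob V x y : vcircuit_wf (size x) V ->
  \sum_(o : (size (flatten (vqueries V))).-tuple bool)
    \sum_b sqmod (@final_state R V x y o b) = 1.
Proof.
case/and3P => wf1 _ wf2.
have sz : size (x ++ nseq (vanc V) false) == (size x + vanc V)%N.
  by rewrite size_cat size_nseq.
rewrite -(norm_ket (Tuple sz)) -(norm_run _ wf1) -(norm_project (flatten (vqueries V))).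
apply: eq_bigr => o _; rewrite /final_state norm_run //.
exact: (norm_supply (Tuple (size_bits_read y o))).
Qed.

Definition reject_prob (V : vcircuit) (x y : seq bool) : R :=
  \sum_(o : (size (flatten (vqueries V))).-tuple bool)
    \sum_(b : (size x + vanc V + size (vqueries V))%N.-tuple bool |
          ~~ nth false b 0)
      sqmod (@final_state R V x y o b).

Lemma accept_reject V x y : vcircuit_wf (size x) V ->
  accept_prob R V x y + reject_prob V x y = 1.
Proof.
move=> wf; rewrite -(total_prob y wf) /accept_prob /reject_prob -big_split /=.
by apply: eq_bigr => o _; rewrite [RHS](bigID (fun b : _.-tuple bool => nth false b 0)).
Qed.

Lemma accept_prob_ge0 V x y : 0 <= accept_prob R V x y.
Proof. by apply: sumr_ge0 => o _; apply: sumr_ge0 => b _; exact: sqmod_ge0. Qed.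

(** * Product states *)

(** A gate reads and flips only its own wires, so a factor [rho] that is invariant under flips
    inside the window passes through it. This replaces a tensor product of spaces. *)
Lemma apply_shift L M B g (phi : state R M) (rho : state R L) :
  (B + M <= L)%N -> gate_wf M g ->
  (forall i b, (i < M)%N -> rho (flip (B + i) b) = rho b) ->
  apply_gate (shift_gate B g) (fun b => phi (window M B b) * rho b) =
  (fun b => apply_gate g phi (window M B b) * rho b).
Proof.
move=> BML wf rhoP; apply/funext => b.
have W i : (i < M)%N -> phi (window M B (flip (B + i) b)) * rho (flip (B + i) b) =
    phi (flip i (window M B b)) * rho b.
  by move=> iM; rewrite window_flip // rhoP.
case: g wf => [i|i|i|i j|i j k]; rewrite /gate_wf /=.
- by rewrite andbT => iM; rewrite W.
- by rewrite andbT => iM; rewrite W // nth_window // mulrA -mulrDl mulrAC.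
- by rewrite andbT => iM; rewrite nth_window // mulrA.
- move=> /andP[_ /and3P[iM jM _]]; rewrite nth_window //.
  by case: ifP => _; rewrite ?W.
- move=> /andP[_ /and4P[iM jM kM _]]; rewrite !nth_window //.
  by case: ifP => _; rewrite ?W.
Qed.

Lemma run_shift L M B gs (phi : state R M) (rho : state R L) :
  (B + M <= L)%N -> all (gate_wf M) gs ->
  (forall i b, (i < M)%N -> rho (flip (B + i) b) = rho b) ->
  run (map (shift_gate B) gs) (fun b => phi (window M B b) * rho b) =
  (fun b => run gs phi (window M B b) * rho b).
Proof.
move=> BML wf rhoP; elim: gs phi wf => //= g gs IH phi /andP[wf wfs].
by rewrite apply_shift // IH.
Qed.

Definition blocks (L t M : nat) (Phi : nat -> state R M) (rho : state R L) : state R L :=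
  fun b => (\prod_(j < t) Phi j (window M (j * M) b)) * rho b.

Lemma run_block L t M j gs (Phi : nat -> state R M) (rho : state R L) :
  (t * M <= L)%N -> (j < t)%N -> all (gate_wf M) gs ->
  (forall i b, (i < t * M)%N -> rho (flip i b) = rho b) ->
  run (map (shift_gate (j * M)) gs) (blocks t Phi rho) =
  blocks t (fun i => if i == j then run gs (Phi i) else Phi i) rho.
Proof.
move=> tML jt wf rhoP.
have jM i : (i < t)%N -> (i * M + M <= t * M)%N.
  by move=> it; rewrite -mulSnr leq_mul2r it orbT.
pose jo := Ordinal jt.
(* Seen from block [j], all other blocks belong to the spectator factor. *)
pose rho' (b : L.-tuple bool) := (\prod_(i < t | i != jo) Phi i (window M (i * M) b)) * rho b.
have E (P : nat -> state R M) : (forall i, i != j -> P i = Phi i) ->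
   blocks t P rho = fun b => P j (window M (j * M) b) * rho' b.
  move=> PE; apply/funext => b; rewrite /blocks (bigD1 jo) //= /rho' mulrA; congr (_ * _ * _).
  by apply: eq_bigr => i ij; rewrite PE.
rewrite (E Phi) // E => [|i /negPf->//].
rewrite eqxx; apply: run_shift => //; first exact: leq_trans (jM _ jt) tML.
move=> i b iM; have lt : (j * M + i < t * M)%N by apply: leq_trans (jM _ jt); rewrite ltn_add2l.
rewrite /rho' rhoP //; congr (_ * _); apply: eq_bigr => k kj.
rewrite window_flip_out //; first exact: leq_trans (jM _ (ltn_ord k)) tML.
have : (k < j)%N || (j < k)%N by rewrite -neq_ltn.
case/orP => kj'; apply/orP; [right|left].
  by apply: leq_trans (leq_addr _ _); rewrite -mulSnr leq_mul2r kj' orbT.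
by apply: (@leq_trans (j * M + M)); rewrite ?ltn_add2l // -mulSnr leq_mul2r kj' orbT.
Qed.

Lemma run_blocks L t M gs (Phi : nat -> state R M) (rho : state R L) :
  (t * M <= L)%N -> all (gate_wf M) gs ->
  (forall i b, (i < t * M)%N -> rho (flip i b) = rho b) ->
  run (flatten [seq map (shift_gate (j * M)) gs | j <- iota 0 t]) (blocks t Phi rho) =
  blocks t (fun i => run gs (Phi i)) rho.
Proof.
move=> tML wf rhoP.
have H s : uniq s -> all (fun j => j < t)%N s -> forall Phi : nat -> state R M,
  run (flatten [seq map (shift_gate (j * M)) gs | j <- s]) (blocks t Phi rho) =
  blocks t (fun i => if i \in s then run gs (Phi i) else Phi i) rho.
  elim: s => //= j s IH /andP[js us] /andP[jt st] P.
  rewrite run_cat run_block // IH //.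
  congr (blocks _ _ _); apply/funext => i; rewrite inE.
  by case: eqP => [->|]; rewrite ?(negPf js).
rewrite H ?iota_uniq //; last by apply/allP => j; rewrite mem_iota.
apply/funext => b; congr (_ * _); apply: eq_bigr => i _.
by rewrite mem_iota /= add0n ltn_ord.
Qed.

(** Targets are distinct and never controls, so the gates commute and the circuit is its own
    inverse. Hence the basis state [b'] at which the old amplitude is read obeys the same
    exclusive-or rule as the image of [b]. *)
Lemma run_cnots L cs (b : L.-tuple bool) :
  all (fun e => (e.1 < L)%N && (e.2 < L)%N) cs -> uniq (unzip2 cs) ->
  (forall e, e \in cs -> e.1 \notin unzip2 cs) ->
  exists b' : L.-tuple bool, [/\ forall psi : state R L, run (cnots cs) psi b = psi b',
    forall e, e \in cs -> nth false b' e.2 = nth false b e.2 (+) nth false b e.1 &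
    forall p, p \notin unzip2 cs -> nth false b' p = nth false b p].
Proof.
elim: cs => [_ _ _|[c d] cs IH] /=; first by exists b.
move=> /andP[/andP[cL dL] csL] /andP[dcs ucs] cP.
have cs_c e : e \in cs -> (e.1 != d) && (e.1 \notin unzip2 cs).
  by move=> ecs; rewrite -negb_or -in_cons; apply: cP; rewrite inE ecs orbT.
have [|b1 [b1P b1t b1o]] := IH csL ucs; first by move=> e /cs_c/andP[].
have /norP[cd ccs] : ~~ ((c == d) || (c \in unzip2 cs)).
  by rewrite -in_cons; apply: (cP (c, d)); rewrite mem_head.
have b2 p : nth false (act (GCNOT c d) b1) p = nth false b1 p (+) (nth false b c && (p == d)).
  by rewrite nth_act /= ?(b1o c) // /gate_wf /= inE cd cL dL.
exists (act (GCNOT c d) b1); split=> [psi|e|p].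
- by rewrite [LHS]b1P.
- rewrite inE => /orP[/eqP-> /=|ecs]; first by rewrite b2 eqxx andbT b1o.
  have ed : e.2 == d = false.
    by apply: contraNF dcs => /eqP<-; apply: map_f.
  by rewrite b2 ed andbF addbF b1t.
- by rewrite inE negb_or => /andP[/negPf pd pcs]; rewrite b2 pd andbF addbF b1o.
Qed.

End Amplitudes.

Local Open Scope nat_scope.

(** * The amplified circuit *)

(** Sources have stride [r] and targets stride [s]. This covers fanning out the input ([r = 0]),
    distributing the supplied bits, and collecting the answers ([s = 1]). *)
Definition copies (js : seq nat) (c r d s len : nat) : seq (nat * nat) :=
  flatten [seq ladder (c + j * r) (d + j * s) len | j <- js].

Lemma mem_copies js c r d s len j i : j \in js -> i < len ->
  (c + j * r + i, d + j * s + i) \in copies js c r d s len.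
Proof.
move=> jjs il; apply/flattenP; exists (ladder (c + j * r) (d + j * s) len).
  exact: (map_f (fun j => ladder (c + j * r) (d + j * s) len)).
by apply: (map_f (fun i => (c + j * r + i, d + j * s + i))); rewrite mem_iota.
Qed.

Lemma copiesP js c r d s len e : e \in copies js c r d s len ->
  exists j i, [/\ j \in js, i < len & e = (c + j * r + i, d + j * s + i)].
Proof.
move=> /flattenP[l /mapP[j jjs ->]]; rewrite /ladder => /mapP[i + ->].
rewrite mem_iota => il; by exists j, i.
Qed.

Lemma mem_targets js c r d s len p :
  p \in unzip2 (copies js c r d s len) ->
  exists j i, [/\ j \in js, i < len & p = d + j * s + i].
Proof. by move=> /mapP[e /copiesP[j [i [jjs il ->]]] ->]; exists j, i. Qed.

Lemma uniq_targets js c r d s len : uniq js -> len <= s ->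
  uniq (unzip2 (copies js c r d s len)).
Proof.
move=> ujs ls.
have -> : unzip2 (copies js c r d s len) =
    [seq d + j * s + i | j <- js, i <- iota 0 len].
  by rewrite /unzip2 map_flatten -map_comp; congr flatten; apply: eq_map => j /=;
    rewrite -map_comp.
apply: allpairs_uniq; rewrite ?iota_uniq // => -[j i] [j' i'].
move=> /allpairsP[[j1 i1] /= [_ + [-> ->]]] /allpairsP[[j2 i2] /= [_ + [-> ->]]].
rewrite !mem_iota => i1l i2l E.
have E' : j1 * s + i1 = j2 * s + i2 by lia.
have i1s : i1 < s by lia.
have i2s : i2 < s by lia.
have jj : j1 = j2.
  have := congr1 (divn^~ s) E'; rewrite !divnMDl; try lia.
  by rewrite !divn_small // !addn0.
by rewrite jj in E' *; congr pair; lia.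
Qed.

Lemma fwd_env_cnots cs e : uniq (unzip2 cs) ->
  (forall f, f \in cs -> f.1 \notin unzip2 cs) ->
  (forall f, f \in cs -> fwd_env (cnots cs) e f.2 = e f.2 (+) e f.1) /\
  (forall p, p \notin unzip2 cs -> fwd_env (cnots cs) e p = e p).
Proof.
elim: cs e => [//|[c d] cs IH] e /= /andP[dcs ucs] cP.
have cs_c f : f \in cs -> (f.1 != d) && (f.1 \notin unzip2 cs).
  by move=> fcs; rewrite -negb_or -in_cons; apply: cP; rewrite inE fcs orbT.
have [|t1 o1] := IH (act_env (GCNOT c d) e) ucs; first by move=> f /cs_c/andP[].
split=> [f|p]; rewrite inE.
  move=> /orP[/eqP-> /=|fcs]; first by rewrite o1 //= eqxx andbT.
  have [/andP[/negPf f1d _] fE] := (cs_c f fcs, t1 f fcs); rewrite fE /= f1d.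
  have -> : (f.2 == d) = false by apply: contraNF dcs => /eqP<-; apply: map_f.
  by rewrite !andbF !addbF.
by rewrite negb_or => /andP[/negPf pd pcs]; rewrite o1 //= pd andbF addbF.
Qed.

Section Amplify.
(** [t]: number of copies; [G]: circuit on [D] wires computing on its last wire
    a function of its first [t] wires. *)
Variables (t D : nat) (G : seq gate).

(** The last wire of a block is never touched; it makes the block nonempty, and
    is its output 0 when the circuit has no wire at all. *)
Definition width (n : nat) (V : vcircuit) : nat :=
  n + vanc V + size (vqueries V) + 1.

(** Copy [j] lives on the wires [[j M, (j + 1) M)], copy 0 in place; the supplied
    bits come after all of them and are first copied into the blocks, so that the
    old gates are merely shifted.  At the end wire 0 and wire [t M] both hold the
    answer of copy 0, so the last two gates put the result of [G] on wire 0. *)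
Definition amplify (n : nat) (V : vcircuit) : vcircuit :=
  let m := n + vanc V in
  let k := size (vqueries V) in
  let M := width n V in
  let js := iota 0 t in
  {| vanc := vanc V + k + 1 + t.-1 * M + D;
     vpre := cnots (copies (iota 1 t.-1) 0 0 0 M n) ++
       flatten [seq map (shift_gate (j * M)) (vpre V) | j <- js];
     vqueries := flatten [seq map (map (addn (j * M))) (vqueries V) | j <- js];
     vpost := cnots (copies js (t * M + D) k m M k) ++
       flatten [seq map (shift_gate (j * M)) (vpost V) | j <- js] ++
       cnots (copies js 0 M (t * M) 1 1) ++ map (shift_gate (t * M)) G ++
       [:: GCNOT (t * M) 0; GCNOT (t * M + D.-1) 0] |}.

Lemma wires_amplify n V : 0 < t -> n + vanc (amplify n V) = t * width n V + D.
Proof. by rewrite /= /width; case: t => //= t' _; rewrite mulSn; lia. Qed.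

Lemma size_queries_amplify n V :
  size (vqueries (amplify n V)) = t * size (vqueries V).
Proof.
rewrite /= size_flatten /shape -map_comp (eq_map (_ : _ =1 fun=> size (vqueries V))).
  by rewrite sumnE big_map big_const_seq count_predT size_iota iter_addn_0 mulnC.
by move=> j /=; rewrite size_map.
Qed.

Lemma flatten_queries_amplify n V :
  flatten (vqueries (amplify n V)) =
  flatten [seq map (addn (j * width n V)) (flatten (vqueries V)) | j <- iota 0 t].
Proof.
rewrite /=; elim: (iota 0 t) => //= j js IH.
by rewrite flatten_cat IH map_flatten.
Qed.

Lemma size_flatten_queries_amplify n V :
  size (flatten (vqueries (amplify n V))) = t * size (flatten (vqueries V)).
Proof.
rewrite flatten_queries_amplify size_flatten /shape -map_comp.
rewrite (eq_map (_ : _ =1 fun=> size (flatten (vqueries V)))).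
  by rewrite sumnE big_map big_const_seq count_predT size_iota iter_addn_0 mulnC.
by move=> j /=; rewrite size_map.
Qed.

Lemma nth_flatten_uniform (T : Type) (x0 : T) (F : nat -> seq T) k j i :
  (forall j, size (F j) = k) -> j < t -> i < k ->
  nth x0 (flatten [seq F j | j <- iota 0 t]) (j * k + i) = nth x0 (F j) i.
Proof.
move=> Fk; have H s : forall j, j < s -> forall a, i < k ->
    nth x0 (flatten [seq F j | j <- iota a s]) (j * k + i) = nth x0 (F (a + j)) i.
  elim: s => //= s IH [|j'] j's a ik /=; rewrite nth_cat Fk; first by rewrite ik addn0.
  rewrite mulSn -addnA ltnNge leq_addr /= addKn IH //.
  by rewrite addSnnS.
by move=> jt ik; rewrite H.
Qed.

Lemma reshape_cat (T : Type) sh sh' (s : seq T) :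
  reshape (sh ++ sh') s =
  reshape sh (take (sumn sh) s) ++ reshape sh' (drop (sumn sh) s).
Proof.
elim: sh s => [|l sh IH] s /=; first by rewrite drop0.
by rewrite take_takel ?leq_addr // IH drop_drop addnC take_drop [in LHS]addnC.
Qed.

(** The bits read depend on the index registers only through their lengths, so shifting the
    registers is invisible, and the joint outcome is cut into one slice per copy. *)
Lemma nth_reads n V y o j i : size o = t * size (flatten (vqueries V)) ->
  j < t -> i < size (vqueries V) ->
  let Q := size (flatten (vqueries V)) in
  nth false (bits_read (amplify n V) y o) (j * size (vqueries V) + i) =
  nth false (bits_read V y (window Q (j * Q) o)) i.
Proof.
move=> so jt ik Q.
pose F j := bits_read V y (window Q (j * Q) o).
have -> : bits_read (amplify n V) y o = flatten [seq F j | j <- iota 0 t].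
  rewrite /bits_read /=.
  have -> : shape (flatten [seq map (map (addn (j * width n V))) (vqueries V) | j <- iota 0 t])
     = flatten (nseq t (shape (vqueries V))).
    elim: (t) 0 => //= s IH a; rewrite /shape map_cat -/(shape _) -/(shape _) IH.
    by congr (_ ++ _); rewrite /shape -map_comp; apply: eq_map => l /=; rewrite size_map.
  suff H s a : (a + s) * Q <= size o ->
    reshape (flatten (nseq s (shape (vqueries V)))) (drop (a * Q) o) =
      flatten [seq reshape (shape (vqueries V)) (window Q (j * Q) o) | j <- iota a s].
    have := H t 0; rewrite mul0n drop0 => ->; last by rewrite so add0n.
    by rewrite map_flatten -map_comp; congr flatten; apply: eq_map.
  elim: s a => [|s IH] a asQ //=.
  have szd : Q <= size (drop (a * Q) o) by rewrite size_drop; nia.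
  have Qs : Q = sumn (shape (vqueries V)) by rewrite /Q size_flatten.
  rewrite -IH; last by rewrite addSnnS.
  have -> : window Q (a * Q) o = take Q (drop (a * Q) o) :> seq bool.
    apply: (@eq_from_nth _ false); rewrite size_tuple.
      by rewrite size_takel.
    by move=> l lQ; rewrite nth_window // nth_take // nth_drop.
  by rewrite reshape_cat -Qs drop_drop -mulSn.
rewrite nth_flatten_uniform // => j'; rewrite /F.
exact/eqP/size_bits_read.
Qed.

End Amplify.

Lemma mem_iota0 j t : (j \in iota 0 t) = (j < t).
Proof. by rewrite mem_iota. Qed.

Lemma nth_input (x : seq bool) a p : nth false (x ++ nseq a false) p = nth false x p.
Proof. by rewrite nth_cat nth_nseq if_same; case: ltnP => // /(nth_default false)->. Qed.

Lemma eq_nthP (s s' : seq bool) L : size s = L -> size s' = L ->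
  reflect (forall p, p < L -> nth false s p = nth false s' p) (s == s').
Proof.
move=> sL sL'; apply: (iffP eqP) => [-> //|H].
by apply: (@eq_from_nth _ false); rewrite ?sL ?sL'.
Qed.

Local Open Scope ring_scope.

Lemma prod_bool (V : comNzSemiRingType) t (B : 'I_t -> bool) :
  \prod_(j < t) ((B j)%:R : V) = [forall j : 'I_t, B j]%:R.
Proof.
case: (boolP [forall j : 'I_t, B j]) => [/forallP H|].
  by rewrite big1 // => j _; rewrite H.
rewrite negb_forall => /existsP[j /negPf Bj].
by rewrite (bigD1 j) //= Bj mul0r.
Qed.

(** * The final state of the amplified circuit as a product over blocks *)

Section FinalState.
Variable R : realType.
Local Notation C := R[i].
Variables (t D : nat) (G : seq gate) (V : vcircuit) (x y : seq bool).
Hypotheses (t_gt0 : (0 < t)%N) (Vwf : vcircuit_wf (size x) V).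

Let n := size x.
Let a := vanc V.
Let k := size (vqueries V).
Let m := (n + a)%N.
Let M := width n V.
Let V' := amplify t D G n V.
Let fq := flatten (vqueries V).
Let Q := size fq.
Let L := (n + vanc V')%N.

Let LE : L = (t * M + D)%N. Proof. exact: wires_amplify. Qed.
Let ME : M = (m + k + 1)%N. Proof. by []. Qed.

Let block_le j : (j < t)%N -> (j * M + M <= t * M)%N.
Proof. by move=> jt; rewrite -mulSnr leq_mul2r jt orbT. Qed.

Definition zero_rest (b : L.-tuple bool) : C :=
  (window D (t * M) b == nseq D false :> seq bool)%:R.

(** The input is a basis state and the target wires hold zeros, so the CNOT gates copy it exactly,
    with no entanglement between blocks. *)
Lemma run_copy_input :
  run (cnots (copies (iota 1 t.-1) 0 0 0 M n)) (@ket R L (x ++ nseq (vanc V') false)) =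
  blocks t (fun=> @ket R M (x ++ nseq (a + k + 1) false)) zero_rest.
Proof.
set cs := copies _ _ _ _ _ _.
have nM : (n <= M)%N by rewrite ME /m; lia.
have jP j : j \in iota 1 t.-1 = (1 <= j < t)%N.
  by rewrite mem_iota add1n prednK.
have csP e : e \in cs -> exists j i, [/\ (1 <= j < t)%N, (i < n)%N & e = (i, (j * M + i)%N)].
  by move=> /copiesP[j [i [jjs il ->]]]; exists j, i; rewrite -jP muln0.
have csT j i : (1 <= j < t)%N -> (i < n)%N -> (i, (j * M + i)%N) \in cs.
  rewrite -jP => jjs il; have := @mem_copies _ 0 0 0 M n j i jjs il.
  by rewrite muln0.
have tgt p : p \in unzip2 cs -> exists j i, [/\ (1 <= j < t)%N, (i < n)%N & p = (j * M + i)%N].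
  by move=> /mem_targets[j [i [jjs il ->]]]; exists j, i; rewrite -jP.
apply/funext => b.
have [|||b' [-> b't b'o]] := @run_cnots R L cs b.
- apply/allP => e /csP[j [i [/andP[_ /block_le jt] il ->]]] /=.
  by rewrite LE; apply/andP; split; lia.
- by apply: uniq_targets; rewrite ?iota_uniq.
- move=> e /csP[j [i [_ il ->]]]; apply/negP => /= /tgt[j' [i' [/andP[j1 _] _]]].
  have := leq_mul j1 (leqnn M); lia.
rewrite /blocks /zero_rest /ket prod_bool -natrM mulnb; congr ((_ : bool)%:R).
have sz : size (x ++ nseq (vanc V') false) = L by rewrite size_cat size_nseq.
have szM : size (x ++ nseq (a + k + 1) false) = M.
  by rewrite size_cat size_nseq ME /m -/n; lia.
have out j i : (1 <= j)%N -> nth false x (j * M + i) = false.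
  move=> j1; rewrite nth_default // -/n.
  have := leq_mul j1 (leqnn M); lia.
have cP p : (t * M <= p)%N -> nth false b' p = nth false b p.
  move=> tp; apply: b'o; apply/negP => /tgt[j [i [/andP[_ /block_le jt] il]]]; lia.
have bP j i : (j < t)%N -> (i < M)%N -> nth false b' (j * M + i) =
    nth false b (j * M + i) (+) ((0 < j)%N && (i < n)%N && nth false b i).
  move=> jt iM; case: (boolP ((0 < j)%N && (i < n)%N)) => [/andP[j0 il]|ji] /=.
    have j1t : (1 <= j < t)%N by rewrite j0.
    by rewrite (b't _ (csT j i j1t il)) /=.
  rewrite addbF b'o //; apply/negP => /tgt[j' [i' [/andP[j'0 _] i'l E]]].
  have jj : j = j'.
    have := congr1 (divn^~ M) E; rewrite !divnMDl; try lia.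
    by rewrite !divn_small ?addn0 //; lia.
  by move: ji E; rewrite jj j'0 /= => il; lia.
have M0 : (0 < M)%N by rewrite ME addn1.
apply/(eq_nthP (size_tuple _) sz)/andP => [H|[/forallP H1 H2] p pL].
  have bx i : (i < M)%N -> nth false b i = nth false x i.
    move=> iM; have := bP 0%N i t_gt0 iM; rewrite mul0n add0n /= addbF => <-.
    by rewrite H ?nth_input // LE; have := block_le t_gt0; lia.
  split; last first.
    apply/(eq_nthP (size_tuple _) (size_nseq _ _)) => p pD.
    rewrite nth_window // nth_nseq pD -cP ?leq_addr // H ?nth_input; last by rewrite LE; lia.
    by rewrite out.
  apply/forallP => j; apply/(eq_nthP (size_tuple _) szM) => i iM.
  rewrite nth_window // nth_input; have := bP j i (ltn_ord j) iM.
  have [->|j0] := posnP j; first by rewrite mul0n add0n bx // addbF.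
  rewrite H ?nth_input ?out //; last by rewrite LE; have := block_le (ltn_ord j); lia.
  rewrite (bx i) //=; case: ltnP => [_|ni] /=; last by rewrite addbF (nth_default _ ni).
  by case: (nth _ b _) (nth _ x _) => [] [].
have bx j i : (j < t)%N -> (i < M)%N -> nth false b (j * M + i) = nth false x i.
  move=> jt iM; have /(eq_nthP (size_tuple _) szM)/(_ i iM) := H1 (Ordinal jt).
  by rewrite nth_window // nth_input.
rewrite nth_input; have [pt|tp] := ltnP p (t * M).
  rewrite (divn_eq p M); have jt : (p %/ M < t)%N by rewrite ltn_divLR.
  have iM : (p %% M < M)%N by rewrite ltn_mod.
  rewrite bP // bx //; have := bx 0%N _ t_gt0 iM; rewrite mul0n add0n => ->.
  have [->|j0] := posnP (p %/ M); first by rewrite addbF.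
  rewrite out //=; case: ltnP => [_|ni] /=; first by rewrite addbb.
  by rewrite addbF (nth_default _ ni).
rewrite cP // -(subnKC tp); have pD : (p - t * M < D)%N by rewrite LE in pL; lia.
have /(eq_nthP (size_tuple _) (size_nseq _ _))/(_ _ pD) := H2.
by rewrite nth_window // => ->; rewrite nth_nseq pD out.
Qed.

Definition block_state (phi : state R m) : state R M :=
  fun c => phi (window m 0 c) * (window k.+1 m c == nseq k.+1 false :> seq bool)%:R.

Lemma shift_gate0 gs : map (shift_gate 0) gs = gs.
Proof. by elim: gs => //= g gs ->; case: g. Qed.

Lemma run_sub K N B (gs : seq gate) (phi : state R K) (f : seq bool -> C) :
  (K <= B)%N -> (B <= N)%N -> all (gate_wf K) gs ->
  run gs (fun c : N.-tuple bool => phi (window K 0 c) * f (window (N - B) B c)) =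
  (fun c => run gs phi (window K 0 c) * f (window (N - B) B c)).
Proof.
move=> KB BN wf; rewrite -{1}(shift_gate0 gs).
apply: (@run_shift R N K 0 gs phi (fun c => f (window (N - B) B c))); rewrite ?add0n //.
  exact: leq_trans BN.
move=> i b iK; rewrite window_flip_out // ?subnKC //.
by rewrite (leq_trans iK KB).
Qed.

Definition pre_state : state R m := run (vpre V) (@ket R m (x ++ nseq a false)).

Lemma run_vpre_amplify :
  run (vpre V') (@ket R L (x ++ nseq (vanc V') false)) =
  blocks t (fun=> block_state pre_state) zero_rest.
Proof.
have /and3P[wf1 _ _] := Vwf.
have wfM : all (gate_wf M) (vpre V).
  by apply: sub_all wf1 => g; apply: gate_wfW; rewrite ME /m; lia.
rewrite /= run_cat run_copy_input run_blocks ?LE ?leq_addr //; last first.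
  move=> i b itM; rewrite /zero_rest window_flip_out ?LE // itM //.
congr blocks; apply/funext => _.
have -> : @ket R M (x ++ nseq (a + k + 1) false) =
    fun c => @ket R m (x ++ nseq a false) (window m 0 c) *
     (window (M - m) m c == nseq k.+1 false :> seq bool)%:R.
  apply/funext => c; rewrite /ket -natrM mulnb; congr ((_ : bool)%:R).
  have szM : size (x ++ nseq (a + k + 1) false) = M.
    by rewrite size_cat size_nseq ME /m -/n; lia.
  have szm : size (x ++ nseq a false) = m by rewrite size_cat size_nseq.
  have Mm : (M - m = k.+1)%N by rewrite ME; lia.
  apply/(eq_nthP (size_tuple _) szM)/andP => [H|[/(eq_nthP (size_tuple _) szm) H1]].
    split; first apply/(eq_nthP (size_tuple _) szm) => p pm.
      by rewrite nth_window // H ?nth_input // ME; lia.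
    apply/(eq_nthP (size_tuple _)); rewrite ?Mm ?size_nseq // => p pk.
    rewrite nth_window ?Mm // nth_nseq pk H ?nth_input ?nth_default // -/n; last by rewrite ME; lia.
    by rewrite /m; lia.
  move=> /(eq_nthP (size_tuple _)); rewrite Mm size_nseq => /(_ erefl) H2 p pM.
  rewrite nth_input; have [pm|mp] := ltnP p m.
    by have := H1 p pm; rewrite nth_window // nth_input.
  have pk : (p - m < k.+1)%N by rewrite ME in pM; lia.
  have := H2 _ pk; rewrite nth_window ?Mm // subnKC // => ->.
  by rewrite nth_nseq pk nth_default //; apply: leq_trans mp; rewrite leq_addr.
rewrite (@run_sub m M m (vpre V) _ (fun s => (s == nseq k.+1 false)%:R)) //.
  apply/funext => c; rewrite /block_state; congr (_ * _).
  by have -> : (M - m = k.+1)%N by rewrite ME; lia.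
by rewrite ME; lia.
Qed.

Definition slice (o : seq bool) (j : nat) : Q.-tuple bool := window Q (j * Q) o.

(** The indicator of a joint outcome is the product of the indicators of its slices, because each
    index register lies inside one block. *)
Lemma project_blocks (o : (t * Q).-tuple bool) (Phi : state R m) :
  project (flatten (vqueries V')) o (blocks t (fun=> block_state Phi) zero_rest) =
  blocks t (fun j => block_state (project fq (slice o j) Phi)) zero_rest.
Proof.
have /and3P[_ /allP fqP _] := Vwf.
apply/funext => b; rewrite /project /blocks.
have -> : ([seq nth false b i | i <- flatten (vqueries V')] == o) =
    [forall j : 'I_t, [seq nth false (window m 0 (window M (j * M) b)) i | i <- fq] == slice o j].
  pose F j := [seq nth false b i | i <- [seq (j * M + i)%N | i <- fq]].
  have -> : [seq nth false b i | i <- flatten (vqueries V')] = flatten [seq F j | j <- iota 0 t].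
    by rewrite flatten_queries_amplify map_flatten -map_comp.
  have szF j : size (F j) = Q by rewrite !size_map.
  have FE (j : 'I_t) : F j = [seq nth false (window m 0 (window M (j * M) b)) i | i <- fq].
    rewrite /F -map_comp; apply/eq_in_map => i ifq; have im := fqP i ifq.
    by rewrite window_window ?nth_window ?addn0 // ME; lia.
  have szFt : size (flatten [seq F j | j <- iota 0 t]) = (t * Q)%N.
    rewrite size_flatten /shape -map_comp (eq_map (_ : _ =1 fun=> Q)); last exact: szF.
    by rewrite sumnE big_map big_const_seq count_predT size_iota iter_addn_0 mulnC.
  apply/idP/forallP => [/(eq_nthP szFt (size_tuple o)) H j|H]; last first.
    apply/(eq_nthP szFt (size_tuple o)) => p pQ.
    have Q0 : (0 < Q)%N by case: (Q) pQ; rewrite ?muln0.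
    have jt : (p %/ Q < t)%N by rewrite ltn_divLR.
    have iQ : (p %% Q < Q)%N by rewrite ltn_mod.
    have /eqP E := H (Ordinal jt); rewrite -FE in E.
    by rewrite (divn_eq p Q) (nth_flatten_uniform _ szF) // E nth_window.
  rewrite -FE; apply/(eq_nthP (szF _) (size_tuple _)) => i iQ.
  rewrite nth_window // -H ?(nth_flatten_uniform _ szF) //.
  by apply: (@leq_trans (j * Q + Q)); rewrite ?ltn_add2l // -mulSnr leq_mul2r ltn_ord orbT.
case: ifP => [/forallP H|/negbT].
  congr (_ * _); apply: eq_bigr => j _.
  by rewrite /block_state /project H.
rewrite negb_forall => /existsP[j /negPf Hj].
by rewrite (bigD1 j) //= /block_state /project Hj !mul0r.
Qed.

Let k' := size (vqueries V').
Let k'E : k' = (t * k)%N. Proof. exact: size_queries_amplify. Qed.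

Definition supplied_rest (rd : seq bool) (b : (L + k').-tuple bool) : C :=
  (drop L b == rd)%:R * (window D (t * M) b == nseq D false :> seq bool)%:R.

Lemma supply_blocks (rd : seq bool) (Phi : nat -> state R M) :
  @supply R L k' rd (blocks t Phi zero_rest) = blocks t Phi (supplied_rest rd).
Proof.
apply/funext => b; rewrite /supply /blocks /supplied_rest.
rewrite mulrA; case: eqP => _; rewrite ?mulr0 ?mul0r // mulr1.
rewrite (_ : [tuple _ | i < L] = window L 0 b) // /zero_rest.
congr (_ * _).
  by apply: eq_bigr => j _; rewrite window_window // LE; have := block_le (ltn_ord j); lia.
by rewrite window_window // LE; lia.
Qed.

(** For a fixed outcome the supplied wires hold one known word, so copying out of them keeps the
    product form. Each block then is what [supply] yields in the original circuit, plus the spare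
    zero wire. *)
Lemma run_copy_bits (o : (t * Q).-tuple bool) (phi : nat -> state R m) :
  let rd := bits_read V' y o in
  run (cnots (copies (iota 0 t) (t * M + D) k m M k))
    (blocks t (fun j => block_state (phi j)) (supplied_rest rd)) =
  blocks t (fun j (c : M.-tuple bool) => @supply R m k (bits_read V y (slice o j)) (phi j) (window (m + k) 0 c) *
     (window 1 (m + k) c == [:: false] :> seq bool)%:R) (supplied_rest rd).
Proof.
move=> rd; apply/funext => b; set cs := copies _ _ _ _ _ _.
have kM : (m + k <= M)%N by rewrite ME; lia.
have csP e : e \in cs -> exists j i, [/\ (j < t)%N, (i < k)%N &
    e = (t * M + D + j * k + i, m + j * M + i)%N].
  by move=> /copiesP[j [i [jjs il ->]]]; exists j, i; rewrite -mem_iota0.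
have tgt p : p \in unzip2 cs -> exists j i, [/\ (j < t)%N, (i < k)%N & p = (j * M + (m + i))%N].
  by move=> /mem_targets[j [i [jjs il ->]]]; exists j, i; rewrite -mem_iota0; split=> //; lia.
have [|||b' [-> b't b'o]] := @run_cnots R (L + k') cs b.
- apply/allP => e /csP[j [i [jt il ->]]] /=.
  have := block_le jt; have : (j * k + k <= t * k)%N by rewrite -mulSnr leq_mul2r jt orbT.
  by rewrite LE k'E; lia.
- by apply: uniq_targets; rewrite ?iota_uniq //; lia.
- move=> e /csP[j [i [_ il ->]]]; apply/negP => /= /tgt[j' [i' [/block_le j't i'k]]]; lia.
have out p : (t * M <= p)%N -> nth false b' p = nth false b p.
  by move=> tp; apply: b'o; apply/negP => /tgt[j [i [/block_le jt ik]]]; lia.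
have outb j i : (j < t)%N -> (i < M)%N -> ~~ (m <= i < m + k)%N ->
    nth false b' (j * M + i) = nth false b (j * M + i).
  move=> jt iM ik; apply: b'o; apply/negP => /tgt[j' [i' [j't i'k E]]].
  have jj : j = j'.
    have := congr1 (divn^~ M) E; rewrite !divnMDl; try lia.
    by rewrite !divn_small ?addn0 //; lia.
  by move: E; rewrite jj; lia.
rewrite /blocks.
have -> : supplied_rest rd b' = supplied_rest rd b.
  rewrite /supplied_rest.
  have -> : drop L b' = drop L b.
    apply: (@eq_from_nth _ false); first by rewrite !size_drop !size_tuple.
    by move=> i _; rewrite !nth_drop out // LE; lia.
  suff -> : window D (t * M) b' = window D (t * M) b by [].
  by apply: eq_from_nth_tuple => i iD; rewrite !nth_window // out ?leq_addr.
(* Off the supplied word both amplitudes vanish, so its bits may be assumed to be [rd]. *)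
rewrite /supplied_rest; case: (drop L b =P rd) => [rdE|_]; last by rewrite !mul0r !mulr0.
congr (_ * _); apply: eq_bigr => j _.
have kr : size (bits_read V y (slice o j)) = k by exact/eqP/size_bits_read.
rewrite (@supply_cat R _ _ _ _ _ (window m 0 (window M (j * M) b))
   (window k m (window M (j * M) b))); last first.
  apply/eqP/(eq_nthP (size_tuple _)) => [|i imk]; first by rewrite size_cat !size_tuple.
  rewrite [LHS]nth_window // nth_cat size_tuple; case: ltnP => im.
    by rewrite [RHS]nth_window.
  by rewrite [RHS]nth_window ?subnKC //; lia.
rewrite /block_state mulrAC -natrM mulnb mulrC.
have -> : window m 0 (window M (j * M) b') = window m 0 (window M (j * M) b).
  apply: eq_from_nth_tuple => i im; rewrite !nth_window ?add0n ?outb //; lia.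
congr ((_ : bool)%:R * _).
have rdi i : (i < k)%N -> nth false b (t * M + D + j * k + i) =
    nth false (bits_read V y (slice o j)) i.
  move=> ik; have := @nth_reads t D G n V y o j i (size_tuple o) (ltn_ord j) ik.
  by move=> <-; rewrite -/V' -/rd -rdE nth_drop addnA -LE.
have bi i : (i < k)%N -> nth false b' (j * M + (m + i)) =
    nth false b (j * M + (m + i)) (+) nth false (bits_read V y (slice o j)) i.
  move=> ik; have jt : (j : nat) \in iota 0 t by rewrite mem_iota0.
  have := b't _ (@mem_copies _ (t * M + D) k m M k _ _ jt ik); rewrite /= rdi //.
  by rewrite (_ : j * M + (m + i) = m + j * M + i)%N //; lia.
apply/(eq_nthP (size_tuple _) (size_nseq _ _))/andP => [H|[]].
  split.
    apply/(eq_nthP (size_tuple _) kr) => i ik; have ik1 : (i < k.+1)%N by exact: ltnW.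
    have := H i ik1.
    rewrite !nth_window ?bi //; try by rewrite ?ME; lia.
    by rewrite nth_nseq ik1; case: (nth _ b _) (nth _ _ i) => [] [].
  apply/eqP/(@eq_from_nth _ false); rewrite size_tuple // => -[|//] _.
  have := H k (ltnSn k); rewrite !nth_window ?addn0 ?outb //; try by rewrite ?ME; lia.
  by rewrite nth_nseq ltnSn.
move=> /(eq_nthP (size_tuple _) kr) H1 /eqP/(congr1 (nth false ^~ 0%N)) H2 i.
rewrite ltnS leq_eqVlt nth_nseq => /orP[/eqP->|ik].
  move: H2; rewrite !nth_window ?addn0 ?outb ?ltnSn //; try by rewrite ?ME; lia.
have ik1 : (i < k.+1)%N by exact: ltnW.
have := H1 i ik; rewrite !nth_window ?bi //; try by rewrite ?ME; lia.
by rewrite ik1 => ->; rewrite addbb.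
Qed.

Definition final_block (o : seq bool) (j : nat) : state R M :=
  fun c => @final_state R V x y (slice o j) (window (m + k) 0 c) *
     (window 1 (m + k) c == [:: false] :> seq bool)%:R.

Definition output_gates : seq gate :=
  cnots (copies (iota 0 t) 0 M (t * M) 1 1) ++ map (shift_gate (t * M)) G ++
  [:: GCNOT (t * M) 0; GCNOT (t * M + D.-1) 0].

(** The output gates stay unevaluated: they mix the blocks, but being classical they can be moved
    into the acceptance event. *)
Lemma final_state_amplify (o : (t * Q).-tuple bool) :
  @final_state R V' x y o =
  run output_gates (blocks t (final_block o) (supplied_rest (bits_read V' y o))).
Proof.
have /and3P[_ _ wf2] := Vwf.
have -> : @final_state R V' x y o = run (vpost V') (@supply R L k' (bits_read V' y o)
    (project (flatten (vqueries V')) o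
      (run (vpre V') (@ket R L (x ++ nseq (vanc V') false))))) by [].
rewrite run_vpre_amplify project_blocks supply_blocks.
have -> : vpost V' = cnots (copies (iota 0 t) (t * M + D) k m M k) ++
  flatten [seq map (shift_gate (j * M)) (vpost V) | j <- iota 0 t] ++ output_gates by [].
rewrite run_cat run_copy_bits run_cat run_blocks.
- congr (run _ (blocks _ _ _)); apply/funext => j.
  have Mk : (M - (m + k) = 1)%N by rewrite ME addKn.
  have := @run_sub (m + k) M (m + k) (vpost V)
    (@supply R m k (bits_read V y (slice o j)) (project fq (slice o j) pre_state))
    (fun s => (s == [:: false])%:R) (leqnn _) _ wf2.
  by rewrite Mk => ->; rewrite ?ME ?leq_addr.
- by rewrite LE; lia.
- by apply: sub_all wf2 => g; apply: gate_wfW; rewrite ME; lia.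
- move=> i b itM; rewrite /supplied_rest.
  have -> : drop L (flip i b) = drop L b.
    apply: (@eq_from_nth _ false); rewrite !size_drop !size_tuple // => p pk.
    rewrite !nth_drop nth_flip; last by lia.
    by rewrite (_ : (_ == i) = false) ?addbF //; apply/eqP; rewrite LE; lia.
  by rewrite window_flip_out ?itM // LE; lia.
Qed.

Lemma sum_indicator K (w : K.-tuple bool) (A : K.-tuple bool -> R) :
  \sum_z (val z == w :> seq bool)%:R * A z = A w.
Proof.
rewrite (bigD1 w) //= eqxx mul1r big1 ?addr0 // => z zw.
by rewrite val_eqE (negPf zw) mul0r.
Qed.

(** The share of outcome [o] in the expectation of [lam] at the answer bit, the moment that enters
    the Chernoff bound. *)
Definition weight (lam : bool -> R) (o : seq bool) : R :=
  \sum_(c : (m + k).-tuple bool) lam (nth false c 0) * sqmod (@final_state R V x y o c).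

Lemma sum_weight (lam : bool -> R) :
  \sum_(o : Q.-tuple bool) weight lam o =
  lam true * accept_prob R V x y + lam false * reject_prob R V x y.
Proof.
rewrite /accept_prob /reject_prob !mulr_sumr -big_split /=; apply: eq_bigr => o _.
rewrite /weight (bigID (fun c : _.-tuple bool => nth false c 0)) /= !mulr_sumr.
by congr (_ + _); apply: eq_bigr => c; [move=> -> | move=> /negPf->].
Qed.

Lemma sum_final_block (lam : bool -> R) o j :
  \sum_(c : M.-tuple bool) lam (nth false c 0) * sqmod (final_block o j c) =
  weight lam (slice o j).
Proof.
pose F (c : seq bool) := lam (nth false c 0) *
  (sqmod (@final_state R V x y (slice o j) (window (m + k) 0 c)) *
   (window 1 (m + k) c == [:: false] :> seq bool)%:R).
rewrite (eq_bigr (fun c : M.-tuple bool => F c)) => [|c _]; last first.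
  by rewrite /final_block sqmodM sqmod_nat.
rewrite (@sum_tuple_cast _ _ (m + k + 1) F) // sum_tuple_cat; apply: eq_bigr => c _.
pose w : 1.-tuple bool := [tuple false].
rewrite -[RHS](@sum_indicator 1 w (fun=> _)); apply: eq_bigr => z _.
rewrite /F window_catl ?size_tuple // window_id -[X in window _ X]addn0.
rewrite window_catr ?size_tuple // window_id mulrA mulrC.
case: eqP => [zw|_]; rewrite ?mul0r // !mul1r zw nth_cat size_tuple.
(* If the original circuit has no wires, wire 0 of the block is the spare one; its value [false]
   agrees with the default of [nth]. *)
by case: ltnP => // ck; rewrite [in RHS]nth_default ?size_tuple.
Qed.

Lemma sum_supplied_rest (o : (t * Q).-tuple bool) (f : nat -> M.-tuple bool -> R) :
  \sum_(b : (L + k').-tuple bool) (\prod_(j < t) f j (window M (j * M) b)) *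
     sqmod (supplied_rest (bits_read V' y o) b) =
  \prod_(j < t) \sum_(c : M.-tuple bool) f j c.
Proof.
set rd := bits_read V' y o.
have szrd : size rd = k'.
  have szo : size o == size (flatten (vqueries V')).
    by rewrite size_tuple size_flatten_queries_amplify.
  exact/eqP/(size_bits_read y (Tuple szo)).
pose g (d : (D + k').-tuple bool) : R :=
  (drop D d == rd)%:R * (window D 0 d == nseq D false :> seq bool)%:R.
pose F (b : seq bool) := (\prod_(j < t) f j (window M (j * M) b)) *
  g (window (D + k') (t * M) b).
rewrite (eq_bigr (fun b : (L + k').-tuple bool => F b)) => [|b _]; last first.
  rewrite /F /g /supplied_rest sqmodM !sqmod_nat; congr (_ * (_ * _)).
    congr ((_ == rd)%:R); apply: (@eq_from_nth _ false).
      by rewrite !size_drop !size_tuple; lia.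
    move=> i; rewrite size_drop size_tuple => ik.
    by rewrite !nth_drop nth_window ?addnA -?LE //; lia.
  by rewrite window_window ?addn0 //; lia.
rewrite (@sum_tuple_cast _ _ (t * M + (D + k')) F); last by rewrite LE addnA.
rewrite sum_windows -[RHS]mulr1; congr (_ * _).
pose g' (d : seq bool) : R :=
  (drop D d == rd)%:R * (window D 0 d == nseq D false :> seq bool)%:R.
rewrite (sum_tuple_cat _ _ g').
have szr : size rd == k' by apply/eqP.
transitivity (\sum_(c : D.-tuple bool) ((val c == nseq D false :> seq bool)%:R : R)).
  apply: eq_bigr => c _; rewrite -[RHS](sum_indicator (Tuple szr) (fun=> _)).
  apply: eq_bigr => d _.
  by rewrite /g' drop_size_cat ?size_tuple // window_catl ?size_tuple // window_id.
rewrite -[RHS](sum_indicator [tuple of nseq D false] (fun=> 1)).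
by apply: eq_bigr => c _; rewrite mulr1.
Qed.

(** * Well-formedness, the output bit, and the exponential moment bound *)

Section Bound.
Variable f : (nat -> bool) -> bool.
Hypotheses (tD : (t < D)%N)
  (Gwf : all (fun g => classical g && gate_wf D g) G)
  (fP : forall e e', (forall p, (p < t)%N -> e p = e' p) -> f e = f e')
  (GP : forall e, (forall p, (t <= p < D)%N -> e p = false) ->
     fwd_env G e D.-1 = f e /\
     forall p, ~~ (t <= p < D)%N -> fwd_env G e p = e p).

Lemma shifted_gates_wf K gs : all (gate_wf K) gs -> (K <= M)%N ->
  all (gate_wf L) (flatten [seq map (shift_gate (j * M)) gs | j <- iota 0 t]).
Proof.
move=> wf KM; have : all (fun j => (j < t)%N) (iota 0 t).
  by apply/allP => j; rewrite mem_iota0.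
elim: (iota 0 t) => //= j js IH /andP[/block_le jt /IH IHj].
rewrite all_cat IHj andbT all_map; apply: sub_all wf => g.
case: g => [i|i|i|i i'|i i' l] /=; rewrite /gate_wf /= ?inE LE; lia.
Qed.

Lemma output_gates_wf :
  all (fun g => classical g && gate_wf (L + k') g) output_gates.
Proof.
have tM0 : (0 < t * M)%N by rewrite muln_gt0 t_gt0 ME addn1.
rewrite /output_gates !all_cat; apply/and3P; split.
- rewrite /cnots all_map; apply/allP => e /copiesP[j [i [+ i1 ->]]].
  rewrite mem_iota0 => jt; have := block_le jt.
  by rewrite /= /gate_wf /= inE LE !andbT; lia.
- rewrite all_map; apply: sub_all Gwf => g /andP[cg wfg] /=.
  case: g cg wfg => [i|i|i|i j|i j l] //= _; rewrite /gate_wf /= ?inE LE; lia.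
- by rewrite /= /gate_wf /= !inE LE; lia.
Qed.

Lemma amplify_wf : vcircuit_wf (size x) V'.
Proof.
have /and3P[wf1 /allP wfq wf2] := Vwf.
apply/and3P; split; rewrite -/n -/L.
- have -> : vpre V' = cnots (copies (iota 1 t.-1) 0 0 0 M n) ++
    flatten [seq map (shift_gate (j * M)) (vpre V) | j <- iota 0 t] by [].
  rewrite all_cat; apply/andP; split.
    rewrite /cnots all_map; apply/allP => e /copiesP[j [i [+ il ->]]].
    rewrite mem_iota add1n prednK // => /andP[j0 /block_le jt].
    have := leq_mul j0 (leqnn M).
    by rewrite /= /gate_wf /= inE LE !andbT; lia.
  by apply: shifted_gates_wf wf1 _; rewrite ME /m; lia.
- rewrite flatten_queries_amplify; apply/allP => p /flattenP[l /mapP[j + ->]].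
  rewrite mem_iota0 => /block_le jt /mapP[i /wfq iL ->].
  by rewrite -/M LE; lia.
have -> : vpost V' = cnots (copies (iota 0 t) (t * M + D) k m M k) ++
  flatten [seq map (shift_gate (j * M)) (vpost V) | j <- iota 0 t] ++ output_gates by [].
rewrite all_cat all_cat; apply/and3P; split.
- rewrite /cnots all_map; apply/allP => e /copiesP[j [i [+ ik ->]]].
  rewrite mem_iota0 => jt; have := block_le jt.
  have : (j * k + k <= t * k)%N by rewrite -mulSnr leq_mul2r jt orbT.
  by rewrite /= /gate_wf /= inE LE -/k' k'E !andbT; lia.
- apply: sub_all (shifted_gates_wf wf2 _) => [g|]; last by rewrite ME leq_addr.
  by apply: gate_wfW; rewrite leq_addr.
- by apply: sub_all output_gates_wf => g /andP[].
Qed.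

Lemma output_bit (b : (L + k').-tuple bool) :
  window D (t * M) b = nseq D false :> seq bool ->
  nth false (fwd output_gates b) 0 = f (fun j => nth false b (j * M)).
Proof.
move=> b0; have tM0 : (0 < t * M)%N by rewrite muln_gt0 t_gt0 ME addn1.
rewrite nth_fwd; last by apply: sub_all output_gates_wf => g /andP[].
rewrite /output_gates !fwd_env_cat.
set cs := copies _ _ _ _ _ _; set e := nth false b.
have e0 p : (p < D)%N -> e (t * M + p)%N = false.
  move=> pD; have := nth_window (t * M) b pD; by rewrite b0 nth_nseq pD.
have tgt p : p \in unzip2 cs -> exists2 j, (j < t)%N & p = (t * M + j)%N.
  move=> /mem_targets[j [i [jt i1 ->]]]; exists j; first by rewrite -mem_iota0.
  by lia.
have [||t1 o1] := @fwd_env_cnots cs e.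
- by apply: uniq_targets; rewrite ?iota_uniq.
- move=> g /copiesP[j [i [+ i1 ->]]]; rewrite mem_iota0 => /block_le jt.
  by apply/negP => /= /tgt[j' _]; lia.
set e1 := fwd_env (cnots cs) e.
have e1t j : (j < t)%N -> e1 (t * M + j)%N = e (j * M)%N.
  move=> jt; have jt' : j \in iota 0 t by rewrite mem_iota0.
  have := t1 _ (mem_copies 0 M (t * M) 1 jt' (ltn0Sn 0)).
  rewrite /= !addn0 add0n muln1 /e1 => ->; rewrite e0 //.
  exact: ltn_trans tD.
have e1D p : (t <= p < D)%N -> e1 (t * M + p)%N = false.
  move=> pD; rewrite /e1 o1 ?e0 //; first by lia.
  by apply/negP => /tgt[j jt]; lia.
have [GD Go] := GP (e := fun p => e1 (t * M + p)%N) e1D.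
set e2 := fwd_env _ e1.
have e2E p : e2 (t * M + p)%N = fwd_env G (fun p => e1 (t * M + p)%N) p by exact: fwd_env_shift.
have e20 : e2 0%N = e 0%N.
  rewrite /e2 fwd_env_shift_lt // /e1 o1 //.
  by apply/negP => /tgt[j jt]; lia.
have e2t : e2 (t * M)%N = e 0%N.
  rewrite -[X in e2 X]addn0 e2E Go; last by lia.
  by rewrite e1t.
(* Wire 0 still holds the answer of copy 0, so the first of the last two gates clears it and the
   second writes the value of [f]. *)
rewrite /=; have -> : (t * M + D.-1 == 0)%N = false by apply/eqP; lia.
rewrite e20 e2t e2E GD andbT andbF !addbF addbb andbT addFb.
by apply: fP => p pt; rewrite e1t.
Qed.

(** The indicator of the event is dominated by the product of weights, whose expectation factors
    over the copies. Taking [P] as identity or negation serves soundness and completeness alike. *)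
Lemma amplify_bound (P : pred bool) (lam : bool -> R) :
  (forall b, 0 <= lam b) ->
  (forall e, P (f e) -> 1 <= \prod_(j < t) lam (e j)) ->
  \sum_(o : (size (flatten (vqueries V'))).-tuple bool)
    \sum_(b : (size x + vanc V' + size (vqueries V'))%N.-tuple bool | P (nth false b 0))
      sqmod (@final_state R V' x y o b) <=
  (lam true * accept_prob R V x y + lam false * reject_prob R V x y) ^+ t.
Proof.
move=> lam0 lamP.
pose A (o : seq bool) := \sum_(b : (L + k').-tuple bool | P (nth false b 0))
  sqmod (@final_state R V' x y o b).
rewrite (@sum_tuple_cast _ _ (t * Q) A); last exact: size_flatten_queries_amplify.
apply: (@le_trans _ _ (\sum_(o : (t * Q).-tuple bool)
   \prod_(j < t) weight lam (slice o j))).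
  apply: ler_sum => o _; rewrite /A.
  rewrite final_state_amplify sum_run_classical; last exact: output_gates_wf.
  under [leRHS]eq_bigr do rewrite -sum_final_block.
  rewrite -(@sum_supplied_rest o (fun j c => lam (nth false c 0) * sqmod (final_block o j c))).
  rewrite [leLHS]big_mkcond; apply: ler_sum => b _.
  rewrite /blocks sqmodM sqmod_prod.
  have p0 : 0 <= \prod_(j < t) (lam (nth false (window M (j * M) b) 0) *
      sqmod (final_block o j (window M (j * M) b))).
    by apply: prodr_ge0 => j _; rewrite mulr_ge0 ?lam0 ?sqmod_ge0.
  have r0 := sqmod_ge0 (supplied_rest (bits_read V' y o) b).
  case: ifP => [Pb|_]; last by rewrite mulr_ge0.
  have [b0|b0] := eqVneq (window D (t * M) b : seq bool) (nseq D false); last first.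
    by rewrite /supplied_rest (negPf b0) mulr0 sqmod0 !mulr0.
  rewrite ler_wpM2r // big_split /= ler_peMl //.
    by apply: prodr_ge0 => j _; rewrite sqmod_ge0.
  rewrite output_bit // in Pb; apply: le_trans (lamP _ Pb) _.
  rewrite le_eqVlt; apply/orP; left; apply/eqP; apply: eq_bigr => j _.
  by rewrite nth_window ?addn0 // ME addn1.
have := @sum_windows R t Q 0 (fun=> weight lam) (fun=> 1).
pose B (o : seq bool) := \prod_(j < t) weight lam (slice o j).
rewrite (@sum_tuple_cast _ (t * Q) (t * Q + 0) B); last by rewrite addn0.
rewrite /B; under eq_bigr do rewrite mulr1.
move=> ->; rewrite sum_weight big_const_ord.
rewrite (_ : \sum_(d : 0.-tuple bool) 1 = 1) ?mulr1; last first.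
  by rewrite big_const /= card_tuple expn0 /= addr0.
by rewrite iter_mulr_1.
Qed.

End Bound.
End FinalState.

Local Open Scope nat_scope.

(** * Uniformity and the Chernoff bound *)

Lemma list_pt_copies js c r d s len : unary_pt c -> unary_pt r -> unary_pt d ->
  unary_pt s -> unary_pt len ->
  list_pt (fun n => map gate_data (cnots (copies js (c n) (r n) (d n) (s n) (len n)))).
Proof.
move=> pc pr pd ps pl.
apply: (@poly_time_ext (fun n => body (flatten [seq map gate_data
   (cnots (ladder (c n + j * r n) (d n + j * s n) (len n))) | j <- js]))).
  move=> n; rewrite /cnots /copies !map_flatten -!map_comp; by congr (body (flatten _)).
apply: (@list_pt_flatten (fun j n => map gate_data
  (cnots (ladder (c n + j * r n) (d n + j * s n) (len n))))) => j.
by apply: list_pt_ladder => //; apply: unary_ptD => //; apply: unary_ptMl.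
Qed.

Lemma list_pt_shifts keep js M L : unary_pt M -> list_pt L ->
  list_pt (fun n => flatten [seq map (shift_list keep (j * M n)) (L n) | j <- js]).
Proof.
move=> pM pL; apply: (@list_pt_flatten (fun j n =>
  map (shift_list keep (j * M n)) (L n))) => j.
by apply: list_pt_shift => //; apply: unary_ptMl.
Qed.

Lemma gate_data_shifts js M gs :
  map gate_data (flatten [seq map (shift_gate (j * M)) gs | j <- js]) =
  flatten [seq map (shift_list true (j * M)) (map gate_data gs) | j <- js].
Proof.
rewrite map_flatten -map_comp; congr flatten; apply: eq_map => j /=.
exact: gate_data_shift.
Qed.

(** With [t], [D] and [G] constant, every offset is a fixed linear combination of [n], the number of
    ancillas, the number of queries and 1. *)
Lemma poly_time_amplify t D G V : poly_time_family V ->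
  poly_time_family (fun n => amplify t D G n (V n)).
Proof.
move=> pV; have pn : unary_pt id := poly_time_id.
have [pa pk] := (unary_pt_vanc pV, unary_pt_queries pV).
have pm : unary_pt (fun n => n + vanc (V n)) := unary_ptD pn pa.
have p1 c : unary_pt (fun=> c) := unary_pt_const c.
have pM : unary_pt (fun n => width n (V n)) := unary_ptD (unary_ptD pm pk) (p1 1).
have ptM := unary_ptMl t pM.
have ptMD := unary_ptD ptM (p1 D).
apply: poly_time_family_of.
- exact: (unary_ptD (unary_ptD (unary_ptD (unary_ptD pa pk) (p1 1)) (unary_ptMl t.-1 pM)) (p1 D)).
- apply: (@poly_time_ext (fun n => body (
    map gate_data (cnots (copies (iota 1 t.-1) 0 0 0 (width n (V n)) n)) ++
    flatten [seq map (shift_list true (j * width n (V n))) (map gate_data (vpre (V n)))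
      | j <- iota 0 t]))) => [n|].
    by rewrite /= map_cat gate_data_shifts.
  by apply: list_pt_cat; [exact: list_pt_copies | apply: list_pt_shifts => //; exact: list_pt_vpre].
- by apply: (@list_pt_shifts false) => //; exact: list_pt_queries.
(* The wires of the last two gates depend on [n], so these gates are written as ladders of length
   one. *)
- apply: (@poly_time_ext (fun n => body (
    map gate_data (cnots (copies (iota 0 t) (t * width n (V n) + D) (size (vqueries (V n)))
      (n + vanc (V n)) (width n (V n)) (size (vqueries (V n))))) ++
    flatten [seq map (shift_list true (j * width n (V n))) (map gate_data (vpost (V n)))
      | j <- iota 0 t] ++
    map gate_data (cnots (copies (iota 0 t) 0 (width n (V n)) (t * width n (V n)) 1 1)) ++
    map (shift_list true (t * width n (V n))) (map gate_data G) ++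
    map gate_data (cnots (ladder (t * width n (V n)) 0 1)) ++
    map gate_data (cnots (ladder (t * width n (V n) + D.-1) 0 1))))) => [n|].
    by rewrite /= !map_cat gate_data_shifts gate_data_shift /= !addn0.
  apply: list_pt_cat; first exact: list_pt_copies.
  apply: list_pt_cat; first by apply: list_pt_shifts => //; exact: list_pt_vpost.
  apply: list_pt_cat; first exact: list_pt_copies.
  apply: list_pt_cat.
    by apply: list_pt_shift => //; exact: list_pt_const.
  apply: list_pt_cat; apply: list_pt_ladder => //.
  exact: (unary_ptD ptM (p1 D.-1)).
Qed.

Local Open Scope ring_scope.

(** * The tail of the vote and the resulting exponent *)

Section Tail.
Variable R : realType.

Let s : R := Num.sqrt 2.
Let s_gt0 : 0 < s. Proof. by rewrite sqrtr_gt0. Qed.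
Let s2 : s ^+ 2 = 2. Proof. by rewrite sqr_sqrtr. Qed.
Let sV : s^-1 = s / 2.
Proof. by rewrite -s2 expr2 invfM mulrA divff ?mul1r // gt_eqF. Qed.

(** The value of [s * p + s^-1 * (1 - p)] at [p = 1 / 3], using [s^-1 = s / 2]. Its square is
    8/9. *)
Definition tail_base : R := Num.sqrt 2 * (2 / 3).

Lemma tail_base_gt0 : 0 < tail_base. Proof. by rewrite mulr_gt0 ?s_gt0 //; lra. Qed.

Lemma tail_base_lt1 : tail_base < 1.
Proof.
have := s2; have := s_gt0; rewrite /tail_base -/s => s0 s22.
rewrite -(@ltr_pXn2r _ 2) ?nnegrE //; last by rewrite mulr_ge0 ?(ltW s0) //; lra.
by rewrite exprMn s22 expr1n; lra.
Qed.

Definition majority (t : nat) (e : nat -> bool) : bool :=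
  (t./2.+1 <= \sum_(j < t) e j)%N.

(** The weights [s] and [1/s] are the optimal Chernoff weights at bias 1/3. *)
Definition tail_weight (a b : bool) : R := if a == b then s else s^-1.

Lemma tail_weight_ge0 a b : 0 <= tail_weight a b.
Proof. by rewrite /tail_weight; case: ifP; rewrite ?invr_ge0 ltW. Qed.

(** The product is [s] to the number of votes for [a] minus those against. A tie counts as rejection
    and gives exactly 1. *)
Lemma tail_weight_prod t e a : majority t e = a ->
  1 <= \prod_(j < t) tail_weight a (e j).
Proof.
have s1 : 1 <= s by rewrite -[1]sqrtr1 ler_wsqrtr //; lra.
have su : s \is a GRing.unit by rewrite unitfE gt_eqF.
have E (j : 'I_t) : tail_weight true (e j) = s ^+ (2 * e j) / s.
  by rewrite /tail_weight; case: (e j); rewrite ?mul1r // expr2 mulfK // gt_eqF.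
have E' (j : 'I_t) : tail_weight false (e j) = s / s ^+ (2 * e j).
  rewrite /tail_weight; case: (e j); rewrite /= ?divr1 //.
  by rewrite expr2 invfM mulrA divff ?mul1r // gt_eqF.
have S : \prod_(j < t) s ^+ (2 * e j) = s ^+ (2 * \sum_(j < t) e j).
  by rewrite prodrXr big_distrr.
rewrite /majority; case: a => maj.
  under eq_bigr do rewrite E.
  rewrite big_split /= S prodr_const card_ord exprVn -exprB //; last by lia.
  exact: exprn_ege1.
under eq_bigr do rewrite E'.
rewrite big_split /= prodfV S prodr_const card_ord -exprB //; last by lia.
exact: exprn_ege1.
Qed.

(** The mean equals [s * ((1 + p) / 2)], which increases with the probability [p] of a wrong
    answer. *)
Lemma tail_weight_mean (p r : R) : p + r = 1 -> p <= 1 / 3 ->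
  tail_weight true true * p + tail_weight true false * r <= tail_base.
Proof.
have -> : tail_base = s * (2 / 3) by [].
rewrite /tail_weight /= sV => pr p3; have -> : r = 1 - p by lra.
rewrite (_ : s * p + _ = s * ((1 + p) / 2)); last by field.
by rewrite ler_pM2l ?s_gt0 //; lra.
Qed.

Theorem amplify_prob t D G V x y (t_gt0 : (0 < t)%N) (tD : (t < D)%N)
    (Vwf : vcircuit_wf (size x) V)
    (Gwf : all (fun g => classical g && gate_wf D g) G)
    (GP : forall e, (forall p, (t <= p < D)%N -> e p = false) ->
     fwd_env G e D.-1 = majority t e /\
     forall p, ~~ (t <= p < D)%N -> fwd_env G e p = e p) :
  let V' := amplify t D G (size x) V in
  (accept_prob R V x y <= 1 / 3 -> accept_prob R V' x y <= tail_base ^+ t) /\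
  (2 / 3 <= accept_prob R V x y -> 1 - tail_base ^+ t <= accept_prob R V' x y).
Proof.
move=> V'.
have fP e e' : (forall p, (p < t)%N -> e p = e' p) -> majority t e = majority t e'.
  move=> ee; rewrite /majority; congr (_ < _)%N; apply: eq_bigr => j _.
  by rewrite ee.
have bound := @amplify_bound R t D G V x y t_gt0 Vwf _ tD Gwf fP GP.
have sum1 := @accept_reject R V x y Vwf.
have p0 := @accept_prob_ge0 R V x y.
have r0 : 0 <= reject_prob R V x y.
  by apply: sumr_ge0 => o _; apply: sumr_ge0 => b _; exact: sqmod_ge0.
split=> hp.
  apply: le_trans (bound id (tail_weight true) (tail_weight_ge0 true) _) _.
    by move=> e; exact: tail_weight_prod.
  apply: lerXn2r; rewrite ?nnegrE ?(ltW tail_base_gt0) //.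
    by rewrite addr_ge0 // mulr_ge0 ?tail_weight_ge0.
  exact: tail_weight_mean.
have V'wf : vcircuit_wf (size x) V' by exact: (amplify_wf t_gt0 Vwf tD Gwf).
have sum1' := @accept_reject R V' x y V'wf.
suff : reject_prob R V' x y <= tail_base ^+ t by lra.
apply: le_trans (bound negb (tail_weight false) (tail_weight_ge0 false) _) _.
  by move=> e /negbTE; exact: tail_weight_prod.
apply: lerXn2r; rewrite ?nnegrE ?(ltW tail_base_gt0) //.
  by rewrite addr_ge0 // mulr_ge0 ?tail_weight_ge0.
(* Completeness is the soundness estimate with the two answers exchanged. *)
have -> : tail_weight false true = tail_weight true false by [].
have -> : tail_weight false false = tail_weight true true by [].
by rewrite addrC; apply: tail_weight_mean; lra.
Qed.

(** The cap at 1/3 keeps the gap between completeness and soundness positive for every [t]. *)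
Definition error (t : nat) : R := Num.min (1 / 3) (tail_base ^+ t).

Lemma error_gt0 t : 0 < error t.
Proof. by rewrite lt_min exprn_gt0 ?tail_base_gt0 // andbT; lra. Qed.

Definition error_exponent (t : nat) : R := - (ln (error t) / ln 2).

Let ln2_gt0 : 0 < ln (2 : R). Proof. by rewrite ln_gt0 // ltr1n. Qed.

Lemma powR_error t : 2 `^ (- error_exponent t) = error t.
Proof.
rewrite /powR pnatr_eq0 /= /error_exponent opprK mulfVK ?gt_eqF //.
by rewrite lnK // posrE error_gt0.
Qed.

(** The cap only increases the exponent, so the slope is minus the binary logarithm of [tail_base],
    already from [t = 0] on. *)
Lemma error_exponent_Omega : is_Omega_id error_exponent.
Proof.
exists (- (ln tail_base / ln 2)).
  by rewrite oppr_gt0 pmulr_llt0 ?invr_gt0 // ln_lt0 // tail_base_gt0 tail_base_lt1.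
exists 0%N => t _; rewrite /error_exponent mulNr lerN2 mulrAC ler_pM2r ?invr_gt0 //.
rewrite mulr_natr -lnXn ?tail_base_gt0 // ler_ln ?posrE ?exprn_gt0 ?error_gt0 ?tail_base_gt0 //.
by rewrite ge_min lexx orbT.
Qed.
End Tail.

(** One exponent [f] serves all problems and query bounds, and for each problem the proof length
    stays that of the given verifier for every [t]. *)
Theorem proposition6p1 (R : realType) :
  exists f : nat -> R, is_Omega_id f /\
    forall (q : nat -> nat) (A : promise_problem),
      QCPCPq R q A ->
      exists2 p : nat -> nat, poly_bounded p &
        forall t : nat, (0 < t)%N ->
          QCPCP p (fun n => (t * q n)%N)
            (1 - 2 `^ (- f t)) (2 `^ (- f t)) A.
Proof.
exists (@error_exponent R); split; first exact: error_exponent_Omega.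
move=> q A [p pp [_ [V [Vpt Vwf Vq Vc Vs]]]]; exists p => // t t_gt0.
rewrite /QCPCP powR_error.
have err3 : error R t <= 1 / 3 by rewrite ge_min lexx.
split; first by lra.
have [small|big] := leP (tail_base R ^+ t) (1 / 3); last first.
  have -> : error R t = 1 / 3 by apply/min_idPl/ltW.
  exists V; split=> // [n|x /Vc[y yP]].
  - exact: leq_trans (Vq n) (leq_pmull _ t_gt0).
  - by exists y; lra.
have -> : error R t = tail_base R ^+ t by apply/min_idPr.
(* This threshold is the strict majority, and scratch starts right after the [t] collected
   answers. *)
have [_ /(_ t (leqnn t))[G [D [tD Gwf GP]]]] := computable_threshold t./2.+1 (leqnn t).
exists (fun n => amplify t D G n (V n)); split.
- exact: poly_time_amplify.
(* Well-formedness was shown for the length of an input, so a dummy input of length [n] is used. *)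
- move=> n; rewrite -(size_nseq n false).
  by apply: (amplify_wf t_gt0 _ tD Gwf); rewrite size_nseq.
- by move=> n; rewrite size_queries_amplify leq_mul2l Vq orbT.
- move=> x /Vc[y yP]; exists y.
  by have [_] := amplify_prob R y t_gt0 tD (Vwf (size x)) Gwf GP; apply.
- move=> x /Vs H y.
  by have [+ _] := amplify_prob R y t_gt0 tD (Vwf (size x)) Gwf GP; apply; apply: H.
Qed.
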